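(* Let $V$ be a Polish space with Borel $\sigma$-algebra $\mathcal{B}_V$, let $\mathbf{M}(V)$ be the set of probability measures on $(V,\mathcal{B}_V)$, and let $\mathcal{B}_{w^*}$ be the Borel $\sigma$-algebra on $\mathbf{M}(V)$ generated by the weak$^*$ topology. Let $\langle P_I\rangle_{I\in\mathcal{H}(\mathcal{B}_V)}$ be a family of probability measures, where for each finite measurable partition $I\in\mathcal{H}(\mathcal{B}_V)$, $P_I$ is a probability measure on the finite-dimensional simplex $\triangle_I$ (with its Borel $\sigma$-algebra). The following statements are equivalent: (1) The family is projective, i.e. $$P_I = f_{JI}P_J \quad\text{whenever } I\preceq J,$$ and there is a $G_0\in\mathbf{M}(V)$ such that $$\mathbb{E}_{P_I}[X_I]=\phi_I G_0\quad\text{for all } I\in\mathcal{H}(\mathcal{B}_V).$$ (2) There exists a unique probability measure $P$ on $(\mathbf{M}(V),\mathcal{B}_{w^*})$ satisfying $$P_I=\phi_I P\quad\text{for all } I\in\mathcal{H}(\mathcal{B}_V)$$ and $$\mathbb{E}_P[X]=G_0\quad\text{for some } G_0\in\mathbf{M}(V).$$ (The measure $G_0$ in (1) and in (2) is the same.) If either statement holds, $P$ is a Radon measure.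
   Context: A topological space is Polish if it is separable and metrizable by a complete metric. The weak$^*$ topology on $\mathbf{M}(V)$ is the topology of weak convergence of probability measures (the coarsest topology making $x\mapsto\int h\,dx$ continuous for every bounded continuous $h:V\to\mathbb{R}$). $\mathcal{H}(\mathcal{B}_V)$ denotes the set of all finite measurable partitions $I=(A_1,\dots,A_n)$ of $V$, i.e. finite tuples of nonempty, pairwise disjoint sets $A_i\in\mathcal{B}_V$ with union $V$. For $I=(A_1,\dots,A_n)$, the simplex is $$\triangle_I=\Bigl\{x_I\in\mathbb{R}^I : x_I(A_i)\ge 0 \text{ for all } i,\ \sum_{A_i\in I}x_I(A_i)=1\Bigr\},$$ where $\mathbb{R}^I$ is the $n$-dimensional Euclidean space with coordinates labelled by the sets of $I$; $\triangle_I$ carries the relative Euclidean topology and its Borel sets. The evaluation map $\phi_I:\mathbf{M}(V)\to\triangle_I$ is $\phi_I(x)=(x(A_1),\dots,x(A_n))$. For $J=(B_1,\dots,B_m)$ and $I=(A_1,\dots,A_n)$ in $\mathcal{H}(\mathcal{B}_V)$, $I\preceq J$ means that $I$ is a coarsening of $J$: for each $i$ there is $\mathcal{J}_i\subset\{1,\dots,m\}$ with $A_i=\bigcup_{j\in\mathcal{J}_i}B_j$. In that case $f_{JI}:\triangle_J\to\triangle_I$ is defined by $(f_{JI}x_J)(A_i)=\sum_{j\in\mathcal{J}_i}x_J(B_j)$. For a measure $Q$ and a measurable map $g$, $gQ:=Q\circ g^{-1}$ denotes the image measure. $X$ denotes a random variable with values in $\mathbf{M}(V)$ and law $P$, and $X_I$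 one with values in $\triangle_I$ and law $P_I$. Expectations are taken setwise: $\mathbb{E}_P[X]$ is the set function $A\mapsto\int_{\mathbf{M}(V)}x(A)\,P(dx)$, and $\mathbb{E}_{P_I}[X_I]=\int_{\triangle_I}x_I\,P_I(dx_I)\in\triangle_I$. *)

(* Defs.v *)
From HB Require Import structures.
From mathcomp Require Import all_boot all_order all_algebra.
From mathcomp Require Import all_classical all_reals all_analysis.

Set Implicit Arguments.
Unset Strict Implicit.
Unset Printing Implicit Defensive.

Import Order.TTheory GRing.Theory Num.Theory.
Import numFieldNormedType.Exports.

Local Open Scope classical_set_scope.
Local Open Scope ring_scope.

Definition is_metric (R : realType) (V : Type) (d : V -> V -> R) : Prop :=
  [/\ forall x y, 0 <= d x y,
      forall x y, d x y = 0 <-> x = y,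
      forall x y, d x y = d y x &
      forall x y z, d x z <= d x y + d y z].

Definition metrizes (R : realType) (V : topologicalType) (d : V -> V -> R) :
    Prop :=
  forall (x : V) (A : set V),
    nbhs x A <-> exists2 e : R, 0 < e & [set y | d x y < e] `<=` A.

Definition complete_metric (R : realType) (V : topologicalType)
    (d : V -> V -> R) : Prop :=
  forall u : nat -> V,
    (forall e : R, 0 < e -> exists N : nat, forall m n : nat,
      (N <= m)%N -> (N <= n)%N -> d (u m) (u n) < e) ->
    exists l : V, u @ \oo --> l.

Definition separable_space (V : topologicalType) : Prop :=
  exists2 S : set V, countable S & dense S.

Definition polish (R : realType) (V : topologicalType) : Prop :=
  separable_space V /\
  exists d : V -> V -> R, [/\ is_metric d, metrizes d & complete_metric d].

Notation borel T := (g_sigma_algebraType (@open T)).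

(* A [probability] of the library is a function on all subsets, with arbitrary
   values on non-measurable ones.  Normalising these values to 0 makes Leibniz
   equality coincide with equality of measures, so that [pmeasure R T] is the
   set of Borel probability measures on T, without duplicates. *)
Definition null_off_measurable (R : realType) (T : ptopologicalType) :
    set (probability (borel T) R) :=
  [set p | forall A : set (borel T), ~ measurable A -> p A = 0%E].

Definition pmeasure (R : realType) (T : ptopologicalType) : Type :=
  set_type (@null_off_measurable R T).

HB.instance Definition _ (R : realType) (T : ptopologicalType) :=
  Choice.copy (pmeasure R T) (set_type (@null_off_measurable R T)).

Coercion pmeasure_val (R : realType) (T : ptopologicalType)
  (p : pmeasure R T) : probability (borel T) R := val p.

Lemma pmeasure_ext (R : realType) (T : ptopologicalType) (p q : pmeasure R T) :
  (forall A : set (borel T), measurable A -> p A = q A) -> p = q.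
Proof.
move=> pq; apply: val_inj.
have : (pmeasure_val p : set (borel T) -> \bar R) = pmeasure_val q.
  apply/funext => A; have [mA|nA] := pselect (measurable A); first exact: pq.
  by rewrite /pmeasure_val (set_mem (valP p) _ nA) (set_mem (valP q) _ nA).
rewrite /pmeasure_val.
case: (val p) (val q) => f a [g b] /= fg; rewrite {}fg in a *.
congr Probability.Pack.
move: a b => [[a1 a1'] [a2] [a3] [a4] [a5] [a6] [a7]]
  [[b1 b1'] [b2] [b3] [b4] [b5] [b6] [b7]].
by rewrite (Prop_irrelevance a1 b1) (Prop_irrelevance a1' b1')
  (Prop_irrelevance a2 b2) (Prop_irrelevance a3 b3) (Prop_irrelevance a4 b4)
  (Prop_irrelevance a5 b5) (Prop_irrelevance a6 b6) (Prop_irrelevance a7 b7).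
Qed.

Section normalisation.
Context (R : realType) (T : ptopologicalType) (p : probability (borel T) R).
Local Open Scope ereal_scope.

Definition off_measurable0 (A : set (borel T)) : \bar R :=
  if `[< measurable A >] then p A else 0.

Let off_measurable0_set0 : off_measurable0 set0 = 0.
Proof. by rewrite /off_measurable0 measure0; case: ifP. Qed.

Let off_measurable0_ge0 A : 0 <= off_measurable0 A.
Proof. by rewrite /off_measurable0; case: ifP. Qed.

Let off_measurable0_sigma_additive : semi_sigma_additive off_measurable0.
Proof.
move=> F mF tF mUF; rewrite {2}/off_measurable0 asboolT//.
rewrite (_ : (fun n => _) = fun n => \sum_(0 <= i < n) p (F i)).
  exact: measure_semi_sigma_additive.
apply/funext => n; apply: eq_bigr => i _.
by rewrite /off_measurable0 asboolT.
Qed.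

HB.instance Definition _ := isMeasure.Build _ _ _ off_measurable0
  off_measurable0_set0 off_measurable0_ge0 off_measurable0_sigma_additive.

Let off_measurable0_setT : off_measurable0 setT = 1.
Proof.
rewrite /off_measurable0 asboolT; first exact: probability_setT.
exact: (@measurableT _ (borel T)).
Qed.

HB.instance Definition _ :=
  Measure_isProbability.Build _ _ _ off_measurable0 off_measurable0_setT.

Lemma off_measurable0P :
  (off_measurable0 : probability (borel T) R) \in @null_off_measurable R T.
Proof. by apply/mem_set => A mA; rewrite /= /off_measurable0 asboolF. Qed.

Definition normalise : pmeasure R T :=
  exist _ (off_measurable0 : probability (borel T) R) off_measurable0P.

End normalisation.

Definition bounded_continuous (R : realType) (T : topologicalType) : Type :=
  {h : T -> R | continuous h /\ bounded_fun h}.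

Definition integral_against (R : realType) (T : ptopologicalType)
    (h : bounded_continuous R T) (x : pmeasure R T) : R :=
  \int[x]_(v in [set: borel T]) sval h v.

Definition weak_star (R : realType) (T : ptopologicalType) : Type :=
  @sup_topology (pmeasure R T) (bounded_continuous R T)
    (fun h => Topological.class (initial_topology (integral_against h))).

HB.instance Definition _ (R : realType) (T : ptopologicalType) :=
  Topological.copy (pmeasure R T) (weak_star R T).

HB.instance Definition _ (R : realType) (T : ptopologicalType) :=
  isPointed.Build (pmeasure R T)
    (normalise (@dirac _ (borel T) point R : probability (borel T) R)).

Record fpartition (V : ptopologicalType) : Type := FPartition {
  psize : nat ;
  block : 'I_psize -> set V ;
  block_measurable : forall i, measurable (block i : set (borel V)) ;
  block_nonempty : forall i, block i !=set0 ;
  block_disjoint : trivIset setT block ;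
  block_cover : \bigcup_i block i = setT
}.

Section simplex.
Context (R : realType) (V : ptopologicalType).
Implicit Types I J : fpartition V.

Definition simplex_set I : set 'rV[R]_(psize I) :=
  [set x | (forall i, 0 <= x ord0 i) /\ \sum_i x ord0 i = 1].

Definition simplex I : Type := set_type (@simplex_set I).

HB.instance Definition _ I :=
  Topological.copy (simplex I) (set_type (@simplex_set I)).

Definition simplex_val I (x : simplex I) : 'rV[R]_(psize I) := val x.

Lemma simplex_val_ge0 I (x : simplex I) i : 0 <= simplex_val x ord0 i.
Proof. by case: (set_mem (valP x)). Qed.

Lemma sum_simplex_val I (x : simplex I) : \sum_i simplex_val x ord0 i = 1.
Proof. by case: (set_mem (valP x)). Qed.

Lemma evaluation_subproof I (x : pmeasure R V) :
  \row_i fine (x (block i)) \in @simplex_set I.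
Proof.
apply/mem_set; split=> [i|]; first by rewrite mxE fine_ge0.
under eq_bigr do rewrite mxE.
rewrite sum_fine; last first.
  by move=> i _; apply: fin_num_measure; exact: block_measurable.
rewrite -(@measure_bigsetU_ord _ R (borel V) x _ predT).
- rewrite -bigcup_seq (_ : \bigcup_(i in _) _ = setT).
    by rewrite [X in fine X](probability_setT x).
  rewrite -(block_cover I); apply: eq_bigcupl; split=> i //= _.
  exact: mem_index_enum.
- exact: block_measurable.
- exact: block_disjoint.
Qed.

Definition evaluation I (x : pmeasure R V) : simplex I :=
  exist (fun y => y \in @simplex_set I) _ (evaluation_subproof I x).

HB.instance Definition _ I := isPointed.Build (simplex I) (evaluation I point).

(* [s i] is the set of indices of the blocks of J that make up block i of I. *)
Definition coarsening I J (s : 'I_(psize I) -> {set 'I_(psize J)}) : Prop :=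
  forall i, block i = \bigcup_(j in [set j | j \in s i]) block j.

Lemma coarsen_subproof I J (s : 'I_(psize I) -> {set 'I_(psize J)}) :
  coarsening s -> forall x : simplex J,
  \row_i (\sum_(j in s i) simplex_val x ord0 j) \in @simplex_set I.
Proof.
move=> sIJ x; apply/mem_set; split=> [i|].
  by rewrite mxE sumr_ge0// => j _; exact: simplex_val_ge0.
have mem_block i j v : block j v -> block i v -> j \in s i.
  move=> jv; rewrite sIJ => -[k /= ks kv].
  by rewrite (@block_disjoint _ J j k Logic.I Logic.I (ex_intro _ v (conj jv kv))).
have block_mem i j v : block j v -> j \in s i -> block i v.
  by move=> jv ji; rewrite sIJ; exists j.
under eq_bigr do rewrite mxE big_mkcond/=.
rewrite exchange_big/= -(sum_simplex_val x); apply: eq_bigr => j _.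
have [v jv] := block_nonempty j.
have [i _ iv] : (\bigcup_i block (f := I) i) v by rewrite block_cover.
rewrite (bigD1 i)//= (mem_block _ _ _ jv iv) big1 ?addr0// => k ki.
case: ifP => // jk; case/eqP: ki.
apply: (@block_disjoint _ I) => //; exists v; split => //.
exact: block_mem jv jk.
Qed.

Definition coarsen I J (s : 'I_(psize I) -> {set 'I_(psize J)})
    (sIJ : coarsening s) (x : simplex J) : simplex I :=
  exist (fun y => y \in @simplex_set I) _ (coarsen_subproof sIJ x).

End simplex.

(* The maps g used here are measurable, so that g^-1(B) is measurable and the
   values of P off the measurable sets play no role. *)
Definition is_image (R : realType) (S T : ptopologicalType) (g : S -> T)
    (P : pmeasure R S) (Q : pmeasure R T) : Prop :=
  forall B : set (borel T), measurable B ->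
    Q B = pushforward P (g : borel S -> borel T) B.

Definition is_radon (R : realType) (T : ptopologicalType) (P : pmeasure R T) :
    Prop :=
  forall B : set (borel T), measurable B ->
    P B = ereal_sup [set P K | K in
      [set K : set T | [/\ compact K, measurable (K : set (borel T)) &
                           K `<=` B]]].

Section families.
Context (R : realType) (V : ptopologicalType).
Variable P_ : forall I : fpartition V, pmeasure R (simplex R I).

Definition projective_family : Prop :=
  forall (I J : fpartition V) (s : 'I_(psize I) -> {set 'I_(psize J)})
    (sIJ : coarsening s), is_image (coarsen sIJ) (P_ J) (P_ I).

Definition simplex_mean (I : fpartition V) (Q : pmeasure R (simplex R I)) :
    'rV[R]_(psize I) :=
  \row_i \int[Q]_(x in [set: borel (simplex R I)]) simplex_val x ord0 i.

Definition family_mean (G : pmeasure R V) : Prop :=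
  forall I : fpartition V, simplex_mean (P_ I) = simplex_val (evaluation I G).

Definition has_marginals (P : pmeasure R (pmeasure R V)) : Prop :=
  forall I : fpartition V, is_image (@evaluation R V I) P (P_ I).

Definition random_measure_mean (P : pmeasure R (pmeasure R V)) (A : set V) :
    \bar R :=
  \int[P]_(x in [set: borel (pmeasure R V)]) (x : pmeasure R V) A.

Definition has_mean (P : pmeasure R (pmeasure R V)) (G : pmeasure R V) : Prop :=
  forall A : set (borel V), measurable A -> random_measure_mean P A = G A.

End families.

(* Main.v *)
(* An element of M(V) is determined by its values on a countable algebra, and
   the mean G0 controls tightness on both levels. Since each evaluation map
   onto a simplex is surjective, projectivity makes mu(phi_I^-1 B) = P_I(B) a
   well-defined finitely additive content on the cylinder sets of M(V). It is
   continuous at the empty set: given decreasing cylinders of content at least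
   e, choose closed approximations inside the simplices and, for the countably
   many sets A of a generating algebra, compact sets K inside A with G0(A \ K)
   so small that, by Markov's inequality, the content of {x | x(A \ K) > r} is
   negligible. An ultrafilter on what remains of the cylinders gives by limits
   a finitely additive set function on the algebra which is inner regular
   along compact sets, hence countably additive, hence a point of all the
   cylinders. Caratheodory's extension then yields P. Uniqueness holds because
   the cylinders generate the weak* Borel sets (portmanteau theorem and second
   countability). The same ultrafilter argument shows that {x | x(O \ K) <= r
   for all the chosen K, O} is weak* compact, so that P is tight, and open
   sets of M(V) are F_sigma, so that P is Radon. *)
Require Import Defs.
From HB Require Import structures.
From mathcomp Require Import all_boot all_order all_algebra.
From mathcomp Require Import all_classical all_reals all_analysis.
From mathcomp Require Import measurable_realfun borel_hierarchy ring lra.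

Set Implicit Arguments.
Unset Strict Implicit.
Unset Printing Implicit Defensive.

Import Order.TTheory GRing.Theory Num.Theory.
Import numFieldNormedType.Exports.

Local Open Scope classical_set_scope.
Local Open Scope ring_scope.

(** * Probabilities and contents *)

Section mass.
Context d (T : measurableType d) (R : realType).
Implicit Types (p : probability T R) (A B : set T).

Definition mass p A : R := fine (p A).

Lemma massE p A : measurable A -> p A = (mass p A)%:E.
Proof. by move=> mA; rewrite fineK// fin_num_measure. Qed.

Lemma mass_ge0 p A : 0 <= mass p A.
Proof. exact: fine_ge0. Qed.

Lemma mass0 p : mass p set0 = 0.
Proof. by rewrite /mass measure0. Qed.

Lemma massT p : mass p setT = 1.
Proof. by rewrite /mass probability_setT. Qed.

Lemma le_mass p A B : measurable A -> measurable B -> A `<=` B ->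
  mass p A <= mass p B.
Proof.
by move=> mA mB AB; rewrite -lee_fin -!massE// le_measure// ?inE.
Qed.

Lemma mass_le1 p A : measurable A -> mass p A <= 1.
Proof. by move=> mA; rewrite -(massT p) le_mass. Qed.

Lemma massU p A B : measurable A -> measurable B -> A `&` B = set0 ->
  mass p (A `|` B) = mass p A + mass p B.
Proof.
move=> mA mB AB; apply: EFin_inj; rewrite EFinD -!massE//.
  exact: measureU.
exact: measurableU.
Qed.

Lemma massC p A : measurable A -> mass p (~` A) = 1 - mass p A.
Proof.
move=> mA; apply/eqP; rewrite eq_sym subr_eq; apply/eqP.
rewrite -massU ?setUCl ?massT ?setICl//; exact: measurableC.
Qed.

Lemma massD p A B : measurable A -> measurable B ->
  mass p A <= mass p (A `\` B) + mass p B.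
Proof.
move=> mA mB; rewrite -massU//; last by rewrite setDE -setIA setICl setI0.
  by apply: le_mass => //; [apply: measurableU => //; exact: measurableD|
    rewrite setDE => t At; have [Bt|nBt] := pselect (B t); [right|left]].
exact: measurableD.
Qed.

Lemma massU_le p A B : measurable A -> measurable B ->
  mass p (A `|` B) <= mass p A + mass p B.
Proof.
move=> mA mB; have mAB := measurableU _ _ mA mB.
rewrite addrC (le_trans (massD p mAB mA))// [leLHS]addrC addrC lerD2r.
apply: le_mass => //; first exact: measurableD.
by move=> t [[]].
Qed.

Lemma mass_nondecreasing_cvg p (F : (set T)^nat) :
  (forall i, measurable (F i)) -> nondecreasing_seq F ->
  mass p (F n) @[n --> \oo] --> mass p (\bigcup_n F n).
Proof.
move=> mF ndF; apply/fine_cvg; rewrite -massE; last exact: bigcupT_measurable.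
by apply: nondecreasing_cvg_mu => //; exact: bigcupT_measurable.
Qed.

Lemma mass_setDS p A B : measurable A -> measurable B -> B `<=` A ->
  mass p (A `\` B) = mass p A - mass p B.
Proof.
move=> mA mB BA; apply/eqP; rewrite eq_sym subr_eq addrC -massU ?setDUK//.
  exact: measurableD.
by rewrite setDE setICA setICr setI0.
Qed.

Lemma mass_bigsetU_le p (F : (set T)^nat) n : (forall i, measurable (F i)) ->
  mass p (\big[setU/set0]_(i < n) F i) <= \sum_(i < n) mass p (F i).
Proof.
move=> mF; elim: n => [|n ih]; first by rewrite !big_ord0 mass0.
rewrite !big_ord_recr/= (le_trans (massU_le _ _ _)) ?lerD2r//.
exact: bigsetU_measurable.
Qed.

Lemma sum_halves_le (e : R) n : 0 <= e -> \sum_(i < n) e / 2 ^+ i.+1 <= e.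
Proof.
move=> e0; suff -> : \sum_(i < n) e / 2 ^+ i.+1 = e - e / 2 ^+ n.
  by rewrite gerBl divr_ge0// exprn_ge0.
elim: n => [|n ih]; first by rewrite big_ord0 expr0 divr1 subrr.
rewrite big_ord_recr/= ih exprS; set x := 2 ^+ n.
have x0 : x != 0 by rewrite expf_neq0.
by field.
Qed.

Lemma mass_bigcup_le p (F : (set T)^nat) (e : R) : 0 <= e ->
  (forall i, measurable (F i)) -> (forall i, mass p (F i) <= e / 2 ^+ i.+1) ->
  mass p (\bigcup_i F i) <= e.
Proof.
move=> e0 mF Fe; rewrite -bigcup_bigsetU_bigcup.
have mG n : measurable (\big[setU/set0]_(i < n.+1) F i).
  exact: bigsetU_measurable.
have /(mass_nondecreasing_cvg (p := p) mG) cG :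
    nondecreasing_seq (fun n => \big[setU/set0]_(i < n.+1) F i).
  by move=> m n mn; apply/subsetPset; exact: subset_bigsetU.
apply: (cvgr_to_le cG); apply: nearW => n.
apply: le_trans (mass_bigsetU_le p n.+1 mF) _.
by apply: le_trans (sum_halves_le n.+1 e0); exact: ler_sum.
Qed.

End mass.

(** * Algebras of sets and extension of contents *)

Definition is_algebra T (G : set (set T)) :=
  [/\ G set0, setU_closed G & setC_closed G].

Section algebra_theory.
Context (T : Type) (G : set (set T)) (aG : is_algebra G).

Lemma algebra0 : G set0. Proof. by case: aG. Qed.

Lemma algebraU A B : G A -> G B -> G (A `|` B).
Proof. by case: aG => _ + _; exact. Qed.

Lemma algebraC A : G A -> G (~` A).
Proof. by case: aG => _ _; exact. Qed.

Lemma algebraI A B : G A -> G B -> G (A `&` B).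
Proof.
by move=> GA GB; rewrite -(setCK (_ `&` _)) setCI; apply/algebraC/algebraU;
  exact: algebraC.
Qed.

Lemma algebraD A B : G A -> G B -> G (A `\` B).
Proof. by move=> GA GB; rewrite setDE; apply: algebraI => //; exact: algebraC. Qed.

Lemma algebra_bigU (F : (set T)^nat) n : (forall i, G (F i)) ->
  G (\big[setU/set0]_(i < n) F i).
Proof. by move=> GF; elim/big_ind : _ => //; [exact: algebra0|exact: algebraU]. Qed.

Lemma algebraT : G setT.
Proof. by rewrite -setC0; exact/algebraC/algebra0. Qed.

End algebra_theory.

(** The alias remembers [aG], so that the algebra-of-sets structure with measurable sets [G] is
    attached to it and not to [T] itself. *)
Definition algebra_type (T : Type) (G : set (set T)) (aG : is_algebra G) : Type :=
  T.

HB.instance Definition _ (T : pointedType) (G : set (set T))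
  (aG : is_algebra G) := Pointed.on (algebra_type aG).
HB.instance Definition _ (T : pointedType) (G : set (set T))
  (aG : is_algebra G) := isAlgebraOfSets.Build default_measure_display
    (algebra_type aG) (algebra0 aG) (algebraU aG) (algebraC aG).

Section caratheodory_extension.
Context (R : realType) (T : pointedType) (G : set (set T)) (aG : is_algebra G).
Variable mu : set T -> R.
Hypothesis mu_ge0 : forall A, 0 <= mu A.
Hypothesis muT : mu setT = 1.
Hypothesis muU : forall A B, G A -> G B -> A `&` B = set0 ->
  mu (A `|` B) = mu A + mu B.

Lemma content_set0 : mu set0 = 0.
Proof.
have G0 := algebra0 aG.
have := muU G0 G0 (setI0 _); rewrite setU0 => /eqP.
by rewrite -subr_eq0 opprD addrA subrr sub0r oppr_eq0 => /eqP.
Qed.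

Lemma content_le A B : G A -> G B -> A `<=` B -> mu A <= mu B.
Proof.
move=> GA GB AB; rewrite -(setDUK AB) muU// ?lerDl//.
  exact: (algebraD aG).
by rewrite setDE setICA setICr setI0.
Qed.

Lemma content_leU A B : G A -> G B -> mu (A `|` B) <= mu A + mu B.
Proof.
move=> GA GB; have GBA := algebraD aG GB GA.
have -> : A `|` B = A `|` (B `\` A).
  apply/seteqP; split=> x [Ax|]; [by left| |by left|by case; right].
  by have [Ax|nAx] := pselect (A x); [left|right].
rewrite muU//; first by rewrite lerD2l; apply: content_le => // x [].
by rewrite setDE setICA setICr setI0.
Qed.

Lemma content_bigsetU_le (F : (set T)^nat) n : (forall i, G (F i)) ->
  mu (\big[setU/set0]_(i < n) F i) <= \sum_(i < n) mu (F i).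
Proof.
move=> GF; elim: n => [|n ih]; first by rewrite !big_ord0 content_set0.
rewrite !big_ord_recr/= (le_trans (content_leU _ _)) ?lerD2r//.
exact: (algebra_bigU aG).
Qed.

Hypothesis mu_cvg0 : forall F : (set T)^nat, (forall n, G (F n)) ->
  nonincreasing_seq F -> \bigcap_n F n = set0 ->
  forall e : R, 0 < e -> exists n, mu (F n) < e.

Let nu (A : set (algebra_type aG)) : \bar R := (mu A)%:E.

Let nu0 : nu set0 = 0%E.
Proof. by rewrite /nu content_set0. Qed.

Let nu_ge0 A : (0 <= nu A)%E.
Proof. by rewrite lee_fin. Qed.

(** The remainders [D n] of the union decrease to the empty set, so continuity there upgrades finite
    to countable additivity. *)
Let nu_sigma_additive : semi_sigma_additive nu.
Proof.
move=> F GF tF GUF.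
have GbF n : G (\big[setU/set0]_(i < n) F i) by exact: (algebra_bigU aG).
have sumE n : (\sum_(0 <= i < n) nu (F i))%E =
    (mu (\big[setU/set0]_(i < n) F i))%:E.
  elim: n => [|n ih]; first by rewrite big_nil big_ord0 content_set0.
  rewrite big_nat_recr//= ih big_ord_recr/= muU ?EFinD//.
  - exact: GbF.
  - exact: GF.
  - rewrite -subset0 => t [].
  rewrite -bigcup_mkord => -[i /= ni it] nt.
  have := tF i n Logic.I Logic.I (ex_intro _ t (conj it nt)).
  by move=> ine; rewrite ine ltnn in ni.
under eq_fun do rewrite sumE.
apply: cvg_EFin; first exact: nearW.
apply/cvgrPdist_lt => e e0.
pose D n := (\bigcup_i F i) `\` \big[setU/set0]_(i < n) F i.
have GD n : G (D n) by exact: (algebraD aG).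
have niD : nonincreasing_seq D.
  move=> m n mn; apply/subsetPset => t [Ut nt]; split=> //.
  apply: contra_not nt; rewrite -!bigcup_mkord => -[i /= im it].
  by exists i => //=; exact: leq_trans mn.
have D0 : \bigcap_n D n = set0.
  rewrite -subset0 => t Dt; have [[i _ it] _] := Dt 0%N Logic.I.
  have [_] := Dt i.+1 Logic.I; apply.
  by rewrite -bigcup_mkord; exists i => /=.
have [N DN] := mu_cvg0 GD niD D0 e0.
exists N => // n /= Nn.
have -> : mu (\bigcup_i F i) = mu (\big[setU/set0]_(i < n) F i) + mu (D n).
  rewrite -muU//; first by rewrite setDUK// -bigcup_mkord => t [i _ it]; exists i.
  by rewrite /D setDE setICA setICr setI0.
rewrite addrAC subrr add0r ger0_norm//; apply: le_lt_trans DN.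
by apply: content_le => //; apply/subsetPset/niD.
Qed.

HB.instance Definition _ := isMeasure.Build _ _ _ nu nu0 nu_ge0
  nu_sigma_additive.

Let ext_setT : measure_extension nu setT = 1%E.
Proof.
rewrite -[RHS]/(1%:E) -muT; apply: (@measurable_mu_extE _ _ _ nu).
exact: (algebraT aG).
Qed.

HB.instance Definition _ := Measure_isProbability.Build _ _ _
  (measure_extension nu) ext_setT.

(** The extension lives on the sigma-algebra of [G] and is moved to that of [H] as its image under
    the identity, measurable because [H] is included in the former. The value at a member of [G]
    survives since an image measure is computed on preimages. *)
Lemma caratheodory_extension (H : set (set T)) : H `<=` <<s G >> ->
  exists p : probability (g_sigma_algebraType H) R,
    forall A, G A -> p A = (mu A)%:E.
Proof.
move=> HG.
pose S := g_sigma_algebraType (@measurable _ (algebra_type aG)).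
pose f (x : S) : g_sigma_algebraType H := x.
have mf : measurable_fun setT f.
  move=> _ A mA; rewrite setTI; apply: (@smallest_sub _ _ H) mA => //.
  exact: smallest_sigma_algebra.
pose F := mfun_Sub (mem_set mf).
exists (distribution (measure_extension nu) F) => A.
exact: (@measurable_mu_extE _ _ _ nu).
Qed.

End caratheodory_extension.

(** * Approximation of Borel sets by closed and open sets *)

Section closed_regularity.
Context (R : realType) (T : ptopologicalType).

Lemma closed_measurable_borel (A : set T) :
  closed A -> measurable (A : set (borel T)).
Proof.
move=> cA; rewrite -(setCK A); apply: measurableC.
by apply: sub_sigma_algebra; exact: closed_openC.
Qed.

Lemma open_measurable_borel (A : set T) :
  open A -> measurable (A : set (borel T)).
Proof. exact: sub_sigma_algebra. Qed.

Hypothesis openF : forall U : set T, open U -> Fsigma U.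
Variable p : probability (borel T) R.

Definition regular_set (B : set T) := forall e : R, 0 < e ->
  exists C U : set T, [/\ closed C, open U, C `<=` B, B `<=` U &
    mass p (U `\` C) <= e].

Lemma regular_open U : open U -> regular_set U.
Proof.
move=> oU e e0; have [F cF UF] := openF oU.
pose G n := \big[setU/set0]_(i < n.+1) F i.
have mG n : measurable (G n : set (borel T)).
  apply: closed_measurable_borel; apply: closed_bigsetU => i _; exact: cF.
have ndG : nondecreasing_seq G.
  by move=> m n mn; apply/subsetPset; exact: subset_bigsetU.
have GU : \bigcup_n G n = U by rewrite UF bigcup_bigsetU_bigcup.
have := mass_nondecreasing_cvg (p := p) mG ndG; rewrite GU.
move=> /cvgrPdist_le/(_ e e0)[n _ /(_ n (leqnn n))/= ne].
exists (G n), U; split => //.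
- by apply: closed_bigsetU => i _; exact: cF.
- by rewrite -GU; exact: bigcup_sup.
have GnU : G n `<=` U by rewrite -GU; exact: bigcup_sup.
have mU := open_measurable_borel oU.
rewrite mass_setDS//.
exact: le_trans (ler_norm _) ne.
Qed.

(** The regular sets form a sigma-algebra: complements exchange the inner and outer sets, and in a
    countable union a finite part of the closed sets is kept, so that it stays closed. *)
Lemma borel_regular (B : set (borel T)) : measurable B -> regular_set B.
Proof.
apply: smallest_sub; last by move=> U; exact: regular_open.
split.
- exact/regular_open/open0.
- move=> A rA e e0; have [C [U [cC oU CA AU CUe]]] := rA e e0.
  exists (~` U), (~` C); split.
  + exact: open_closedC.
  + exact: closed_openC.
  + by rewrite setTD; exact: subsetC.
  + by rewrite setTD; exact: subsetC.
  + by rewrite setDE setCK setIC -setDE.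
- move=> A rA e e0.
  (* Half of [e] is spread over the sets as a geometric series; the other half pays for truncating
     the union [C] of closed sets to [G n]. *)
  have w0 n : 0 < (e / 2) / 2 ^+ n.+1 by rewrite !divr_gt0// exprn_gt0.
  have /choice[CU CUP] n : exists CU : set T * set T, [/\ closed CU.1,
      open CU.2, CU.1 `<=` A n, A n `<=` CU.2 &
      mass p (CU.2 `\` CU.1) <= (e / 2) / 2 ^+ n.+1].
    by have [C [U ?]] := rA n _ (w0 n); exists (C, U).
  pose K n := (CU n).1; pose L n := (CU n).2.
  pose C := \bigcup_n K n; pose U := \bigcup_n L n.
  pose G n := \big[setU/set0]_(i < n.+1) K i.
  have cG n : closed (G n).
    by apply: closed_bigsetU => i _; case: (CUP i).
  have mG n : measurable (G n : set (borel T)) by exact: closed_measurable_borel.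
  have ndG : nondecreasing_seq G.
    by move=> m n mn; apply/subsetPset; exact: subset_bigsetU.
  have GC : \bigcup_n G n = C by exact: (bigcup_bigsetU_bigcup K).
  have e20 : 0 < e / 2 by rewrite divr_gt0.
  have := mass_nondecreasing_cvg (p := p) mG ndG; rewrite GC.
  move=> /cvgrPdist_le/(_ _ e20)[n _ /(_ n (leqnn n))/= ne].
  have oU : open U by apply: bigcup_open => i _; case: (CUP i).
  have mU := open_measurable_borel oU.
  have mC : measurable (C : set (borel T)).
    rewrite -GC; exact: bigcupT_measurable.
  have GnC : G n `<=` C by rewrite -GC; exact: bigcup_sup.
  exists (G n), U; split => //.
  + by move=> t /GnC[i _ it]; exists i => //; case: (CUP i) => _ _ + _ _; exact.
  + by move=> t [i _ it]; exists i => //; case: (CUP i) => _ _ _ + _; exact.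
  have UG : U `\` G n `<=` (U `\` C) `|` (C `\` G n).
    by move=> t [Ut nGt]; have [Ct|nCt] := pselect (C t); [right|left].
  apply: le_trans (le_mass p _ _ UG) _.
  + exact: measurableD.
  + by apply: measurableU; exact: measurableD.
  apply: le_trans (massU_le _ _ _) _; [exact: measurableD..|].
  rewrite [leRHS](splitr e) lerD//; last first.
    by rewrite mass_setDS//; exact: le_trans (ler_norm _) ne.
  have UC : U `\` C `<=` \bigcup_i (L i `\` K i).
    move=> t [[i _ it] nCt]; exists i => //; split => // it'; apply: nCt.
    by exists i.
  have mUC i : measurable (L i `\` K i : set (borel T)).
    have [? ? _ _ _] := CUP i; apply: measurableD.
      exact: open_measurable_borel.
    exact: closed_measurable_borel.
  apply: le_trans (le_mass p _ _ UC) _.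
  + exact: measurableD.
  + exact: bigcupT_measurable.
  apply: mass_bigcup_le => //; first exact: ltW.
  by move=> i; case: (CUP i).
Qed.

Lemma closed_regularity (B : set (borel T)) (e : R) : measurable B -> 0 < e ->
  exists C : set T, [/\ closed C, C `<=` B & mass p (B `\` C) <= e].
Proof.
move=> mB e0; have [C [U [cC oU CB BU CUe]]] := borel_regular mB e0.
exists C; split => //; apply: le_trans CUe; apply: le_mass.
- by apply: measurableD => //; exact: closed_measurable_borel.
- by apply: measurableD; [exact: open_measurable_borel|exact: closed_measurable_borel].
- by move=> t [Bt nCt]; split => //; exact: BU.
Qed.

End closed_regularity.

(* Boolean terms are countable, hence so is the algebra of their values. *)
Inductive bterm := BFalse | BVar of nat | BNot of bterm | BOr of bterm & bterm.

Fixpoint tree_of_bterm t : GenTree.tree nat :=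
  match t with
  | BFalse => GenTree.Node 0 [::]
  | BVar n => GenTree.Leaf n
  | BNot t => GenTree.Node 1 [:: tree_of_bterm t]
  | BOr t u => GenTree.Node 2 [:: tree_of_bterm t; tree_of_bterm u]
  end.

Fixpoint bterm_of_tree t : bterm :=
  match t with
  | GenTree.Leaf n => BVar n
  | GenTree.Node _ [:: t] => BNot (bterm_of_tree t)
  | GenTree.Node _ [:: t; u] => BOr (bterm_of_tree t) (bterm_of_tree u)
  | _ => BFalse
  end.

Lemma tree_of_btermK : cancel tree_of_bterm bterm_of_tree.
Proof. by elim=> //= [t ->|t -> u ->]. Qed.

HB.instance Definition _ := Countable.copy bterm (can_type tree_of_btermK).

Fixpoint beval T (b : nat -> set T) t : set T :=
  match t with
  | BFalse => set0
  | BVar n => b n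
  | BNot t => ~` beval b t
  | BOr t u => beval b t `|` beval b u
  end.

(** The third clause makes [range a] the least algebra containing the [b n]; it carries
    measurability from the [b n] to the [a n]. *)
Lemma countable_algebra T (b : nat -> set T) : exists a : nat -> set T,
  [/\ is_algebra (range a), forall n, range a (b n) &
    forall H, is_algebra H -> (forall n, H (b n)) -> forall n, H (a n)].
Proof.
pose a n := if unpickle n is Some t then beval b t else set0.
have aE t : range a (beval b t) by exists (pickle t) => //; rewrite /a pickleK.
have aP n : exists t, a n = beval b t.
  by rewrite /a; case: unpickle => [t|]; [exists t|exists BFalse].
exists a; split.
- split; first exact: (aE BFalse).
  + move=> _ _ [n _ <-] [m _ <-].
    have [[t ->] [u ->]] := (aP n, aP m); exact: (aE (BOr t u)).
  + by move=> _ [n _ <-]; have [t ->] := aP n; exact: (aE (BNot t)).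
- by move=> n; exact: (aE (BVar n)).
- move=> H aH Hb n; have [t ->] := aP n; elim: t => //= [|t|t ht u hu].
  + exact: algebra0.
  + exact: algebraC.
  + exact: algebraU.
Qed.

(** * Polish spaces *)

Lemma ultra_bigsetU (T : Type) (F : set_system T) (A : nat -> set T) n :
  UltraFilter F -> F (\big[setU/set0]_(i < n) A i) -> exists i, F (A i).
Proof.
move=> uF; elim: n => [|n ih]; first by rewrite big_ord0 => /filter_not_empty.
rewrite big_ord_recr/= => FU; have [FA|FA] := in_ultra_setVsetC (A n) uF.
  by exists n.
by apply: ih; apply: filterS (filterI FU FA) => t [[]].
Qed.

Lemma natSinv_lt (R : realType) (e : R) : 0 < e -> exists n, n.+1%:R^-1 < e.
Proof.
move=> e0; have [n _ /(_ _ (leqnn n))] := near_infty_natSinv_lt (PosNum e0).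
by exists n.
Qed.

Section metrizable.
Context (R : realType) (V : ptopologicalType) (d : V -> V -> R).
Hypothesis dm : is_metric d.
Hypothesis dV : metrizes d.

Let d_ge0 x y : 0 <= d x y. Proof. by case: dm. Qed.
Let dxx x : d x x = 0. Proof. by case: dm => _ h _ _; exact/h. Qed.
Let dC x y : d x y = d y x. Proof. by case: dm. Qed.
Let dD x y z : d x z <= d x y + d y z. Proof. by case: dm. Qed.

Lemma metric_openP (U : set V) : open U <->
  forall x, U x -> exists2 e : R, 0 < e & [set y | d x y < e] `<=` U.
Proof.
rewrite openE; split=> [UU x /UU|h x /h]; first by move/dV.
by move=> ?; apply/dV.
Qed.

Lemma open_metric_ball x e : open [set y | d x y < e].
Proof.
apply/metric_openP => y /= xy; exists (e - d x y); first by rewrite subr_gt0.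
by move=> z /= yz; apply: le_lt_trans (dD _ y _) _; rewrite -ltrBrDl.
Qed.

Lemma closed_metric_ball x e : closed [set y | d x y <= e].
Proof.
rewrite -[X in closed X]setCK; apply: open_closedC; apply/metric_openP => y.
move=> /= /negP; rewrite -ltNge => xy.
exists (d x y - e); first by rewrite subr_gt0.
move=> z /= yz; apply/negP; rewrite -ltNge.
have := dD x z y; rewrite (dC z y); lra.
Qed.

Lemma nbhs_metric_ball x e : 0 < e -> nbhs x [set y | d x y < e].
Proof. by move=> e0; apply/dV; exists e. Qed.

(** The witness is the distance to the complement, cut off at 1. It is 1-Lipschitz before the cut,
    and at a point of [U] it is at least the radius of a ball inside [U]. *)
Lemma metric_cozero (U : set V) : open U -> exists h : V -> R,
  [/\ continuous h, forall v, 0 <= h v <= 1 & forall v, U v <-> 0 < h v].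
Proof.
(* The full space is apart: its complement is empty and would leave nothing for the infimum to range
   over. *)
move=> oU; have [U0|] := pselect (U = setT).
  exists (cst 1); split=> [|v|v]; rewrite ?U0 ?ler01 ?lexx ?ltr01//.
  exact: cst_continuous.
move=> nUT; have [y0 ny0] : ~` U !=set0.
  apply/set0P/eqP => U0; apply: nUT.
  by rewrite -(setCK U) U0 setC0.
pose D v := [set d v y | y in ~` U].
have D0 v : has_inf (D v).
  by split; [exists (d v y0), y0|exists 0 => _ [y _ <-]].
pose g v := inf (D v).
have g_le v y : ~ U y -> g v <= d v y.
  by move=> nUy; apply: ge_inf; [case: (D0 v)|exists y].
have le_g v e : (forall y, ~ U y -> e <= d v y) -> e <= g v.
  by move=> h; apply: lb_le_inf; [case: (D0 v)|move=> _ [y /h ? <-]].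
have g_lip v w : g v <= d v w + g w.
  rewrite -lerBlDl; apply: le_g => y nUy; rewrite lerBlDl.
  exact: le_trans (g_le v _ nUy) (dD _ _ _).
have cg : continuous g.
  move=> v; apply/cvgrPdist_lt => e e0; apply/dV; exists e => // w /= vw.
  rewrite ltr_norml; have := g_lip v w; have := g_lip w v; rewrite (dC w v); lra.
have g0 v : 0 <= g v by exact: le_g.
exists (fun v => Num.min 1 (g v)); split => [v|v|v].
- by apply: continuous_min; [exact: cst_continuous|exact: cg].
- by rewrite le_min ler01 g0 ge_min lexx.
rewrite lt_min ltr01/=; split=> [Uv|gv].
  have /metric_openP/(_ _ Uv)[e e0 eU] := oU.
  apply: lt_le_trans e0 _; apply: le_g => y nUy; rewrite leNgt.
  by apply/negP => /eU.
by apply: contrapT => nUv; move: gv; rewrite ltNge => /negP; apply;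
  rewrite -(dxx v); exact: g_le.
Qed.

Lemma metric_Fsigma (U : set V) : open U -> Fsigma U.
Proof.
move=> /metric_cozero[h [ch h01 hU]].
exists (fun n => h @^-1` [set r | n.+1%:R^-1 <= r]).
  by move=> n; apply: (closed_comp _ (@closed_ge _ _)) => v _; exact: ch.
apply/seteqP; split=> [v /hU /natSinv_lt[n hn]|v [n _ /= hn]].
  by exists n => //; exact: ltW.
by apply/hU; apply: lt_le_trans hn; rewrite invr_gt0.
Qed.

Hypothesis sepV : separable_space V.

Lemma dense_sequence : exists s : nat -> V,
  forall x (e : R), 0 < e -> exists i, d (s i) x < e.
Proof.
have [S /countable_injP[f injf] dS] := sepV.
(* [s] inverts the injection of [S] into the naturals, with default [point] outside its range. *)
have /choice[s sP] n : exists x, forall z, S z -> f z = n -> x = z.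
  have [[x [Sx fx]]|nS] := pselect (exists x, S x /\ f x = n).
    by exists x => z Sz fz; apply: injf; rewrite ?inE// fx fz.
  by exists point => z Sz fz; exfalso; apply: nS; exists z.
exists s => x e e0.
have [|y [/= xy Sy]] := dS [set y | d x y < e] _ (open_metric_ball x e).
  by exists x; rewrite /= dxx.
by exists (f y); rewrite (sP _ y)// dC.
Qed.

Lemma metric_base : exists b : nat -> set V, (forall n, open (b n)) /\
  forall U x, open U -> U x -> exists n, b n x /\ b n `<=` U.
Proof.
have [s sP] := dense_sequence.
pose B (p : nat * nat) := [set y | d (s p.1) y < p.2.+1%:R^-1].
exists (fun n => if unpickle n is Some p then B p else set0); split.
  by move=> n; case: unpickle => [p|]; [exact: open_metric_ball|exact: open0].
move=> U x /metric_openP oU /oU[e e0 xU].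
(* With radius below [e / 2], a ball containing [x] lies within [e] of [x], hence in [U]. *)
have [n ne] : exists n, n.+1%:R^-1 < e / 2.
  by apply: natSinv_lt; rewrite divr_gt0.
have [i ix] := sP x n.+1%:R^-1 ltac:(by rewrite invr_gt0).
exists (pickle (i, n)); rewrite pickleK; split => // y /= iy; apply: xU => /=.
have {}iy : d (s i) y < n.+1%:R^-1 := iy.
move: ix iy ne; set w := _^-1 => ix iy ne.
by have := dD x (s i) y; rewrite (dC x (s i)); lra.
Qed.

Hypothesis complV : complete_metric d.

(** Any two of the balls in [F] meet, so their centres form a Cauchy sequence. Completeness gives
    its limit, and every neighbourhood of the limit contains one of the balls. *)
Lemma ultra_metric_cvg (F : set_system V) : UltraFilter F ->
  (forall n, exists x, F [set y | d x y <= n.+1%:R^-1]) -> exists l : V, F --> l.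
Proof.
move=> uF /choice[u Fu].
have u_near m n : d (u m) (u n) <= m.+1%:R^-1 + n.+1%:R^-1.
  have /filter_ex[y [/= um un]] : F ([set y | d (u m) y <= m.+1%:R^-1] `&`
      [set y | d (u n) y <= n.+1%:R^-1]).
    exact: filterI.
  have := dD (u m) y (u n); rewrite (dC y (u n)) => h.
  exact: le_trans h (lerD um un).
have inv_le m n : (m <= n)%N -> n.+1%:R^-1 <= m.+1%:R^-1 :> R.
  by move=> mn; rewrite lef_pV2 ?posrE// ler_nat.
have [l ul] : exists l : V, u @ \oo --> l.
  apply: complV => e e0.
  have [N Ne] : exists n, n.+1%:R^-1 < e / 2.
    by apply: natSinv_lt; rewrite divr_gt0.
  exists N => m n Nm Nn; apply: le_lt_trans (u_near m n) _.
  by rewrite (splitr e) ltrD// (le_lt_trans (inv_le N _ _)).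
exists l => A /dV[e e0 lA].
have e20 : 0 < e / 2 by rewrite divr_gt0.
have [N Ne] := natSinv_lt e20.
have [M _ Mu] := ul _ (nbhs_metric_ball l e20).
have := Mu (maxn M N) (leq_maxl _ _).
have := inv_le N (maxn M N) (leq_maxr _ _).
move: (maxn M N) => n /= nN lun; apply: filterS (Fu n) => y /= uny.
apply: lA => /=; apply: le_lt_trans (dD l (u n) y) _.
by rewrite (splitr e) ltrD// (le_lt_trans uny)// (le_lt_trans nN).
Qed.

(** Ulam's theorem. [K] is an intersection, over all radii, of finite unions of closed balls around
    a dense sequence: closed and totally bounded, hence compact. *)
Lemma ulam (p : probability (borel V) R) (e : R) : 0 < e ->
  exists K : set V, [/\ compact K, closed K & mass p (~` K) <= e].
Proof.
move=> e0; have [s sP] := dense_sequence.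
pose B m i := [set y | d (s i) y <= m.+1%:R^-1].
pose C m n := \big[setU/set0]_(i < n) B m i.
have cB m i : closed (B m i) by exact: closed_metric_ball.
have cC m n : closed (C m n).
  by apply: closed_bigsetU => i _; exact: cB.
have mC m n : measurable (C m n : set (borel V)) by exact: closed_measurable_borel.
have /choice[N NP] m : exists n, mass p (~` C m n) <= e / 2 ^+ m.+1.
  have w0 : 0 < e / 2 ^+ m.+1 by rewrite divr_gt0// exprn_gt0.
  have ndC : nondecreasing_seq (C m).
    by move=> k n kn; apply/subsetPset; exact: subset_bigsetU.
  have CT : \bigcup_n C m n = setT.
    rewrite -subTset => x _.
    have [i ix] := sP x m.+1%:R^-1 ltac:(by rewrite invr_gt0).
    by exists i.+1 => //; rewrite /C big_ord_recr/=; right; exact: ltW.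
  have := mass_nondecreasing_cvg (p := p) (mC m) ndC; rewrite CT massT.
  move=> /cvgrPdist_le/(_ _ w0)[n _ /(_ n (leqnn n))/= ne].
  by exists n; rewrite massC//; exact: le_trans (ler_norm _) ne.
pose K := \bigcap_m C m (N m).
exists K; split.
- rewrite compact_ultra => F uF FK.
  have [m|l Fl] := ultra_metric_cvg uF.
    (* An ultrafilter containing a finite union of balls contains one of them. *)
    have : F (C m (N m)) by apply: filterS FK => x; exact.
    by move=> /(ultra_bigsetU uF)[i FB]; exists (s i).
  exists l; split => //; apply: (@closed_cvg _ _ F _ id K) Fl => //.
  by apply: closed_bigI => m _.
- by apply: closed_bigI => m _.
rewrite setC_bigcap; apply: mass_bigcup_le => //; first exact: ltW.
by move=> m; exact: measurableC.
Qed.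

Lemma compact_open_regularity (p : probability (borel V) R)
    (B : set (borel V)) (e : R) : measurable B -> 0 < e ->
  exists K O : set V, [/\ compact K /\ closed K, open O, K `<=` B, B `<=` O &
    mass p (O `\` K) <= e].
Proof.
move=> mB e0; have e20 : 0 < e / 2 by rewrite divr_gt0.
have [C [U [cC oU CB BU UC]]] := borel_regular metric_Fsigma p mB e20.
have [K [kK cK pK]] := ulam p e20.
have mC := closed_measurable_borel cC; have mK := closed_measurable_borel cK.
have mU := open_measurable_borel oU.
exists (C `&` K), U; split => //.
- by split; [rewrite setIC; exact: compact_closedI|exact: closedI].
- by move=> x [/CB].
have h : U `\` (C `&` K) `<=` (U `\` C) `|` ~` K.
  move=> x [Ux nCK]; have [Cx|nCx] := pselect (C x); last by left.
  by right=> Kx; exact: nCK.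
apply: le_trans (le_mass p _ _ h) _.
- by apply: measurableD => //; exact: measurableI.
- by apply: measurableU; [exact: measurableD|exact: measurableC].
apply: le_trans (massU_le _ _ _) _; [exact: measurableD|exact: measurableC|].
by rewrite (splitr e) lerD.
Qed.

End metrizable.

Section polish.
Context (R : realType) (V : ptopologicalType).
Hypothesis polishV : polish R V.

Lemma polish_cozero (U : set V) : open U -> exists h : V -> R,
  [/\ continuous h, forall v, 0 <= h v <= 1 & forall v, U v <-> 0 < h v].
Proof. by have [_ [d [dm dV _]]] := polishV; exact: (metric_cozero dm dV). Qed.

Lemma polish_base : exists b : nat -> set V, (forall n, open (b n)) /\
  forall U x, open U -> U x -> exists n, b n x /\ b n `<=` U.
Proof. by have [sV [d [dm dV _]]] := polishV; exact: (metric_base dm dV sV). Qed.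

Lemma polish_regularity (p : probability (borel V) R) (B : set (borel V))
    (e : R) : measurable B -> 0 < e -> exists K O : set V,
  [/\ compact K /\ closed K, open O, K `<=` B, B `<=` O &
    mass p (O `\` K) <= e].
Proof.
have [sV [d [dm dV cV]]] := polishV.
exact: (compact_open_regularity dm dV sV cV).
Qed.

End polish.

(** * The weak* topology *)

Section bounded_measurable.
Context d (T : measurableType d) (R : realType).
Implicit Types (p : probability T R) (f g : T -> R) (A : set T).

Definition bounded_measurable f :=
  measurable_fun setT f /\ exists M, forall x, `|f x| <= M.

Lemma bounded_measurable_integrable p f : bounded_measurable f ->
  p.-integrable setT (EFin \o f).
Proof.
move=> [mf [M fM]]; apply: measurable_bounded_integrable => //.
  by rewrite ltey_eq fin_num_measure.
exists M; split => [|r Mr x _]; first exact: num_real.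
exact: le_trans (fM x) (ltW Mr).
Qed.

Lemma bounded_measurable_indic A : measurable A ->
  bounded_measurable (\1_A : T -> R).
Proof.
move=> mA; split; first exact: measurable_indic.
by exists 1 => x; rewrite indicE; case: (_ \in _); rewrite ?normr1 ?normr0.
Qed.

Lemma bounded_measurable_cst r : bounded_measurable (cst r : T -> R).
Proof. by split; [exact: measurable_cst|exists `|r|]. Qed.

Lemma bounded_measurableD f g : bounded_measurable f -> bounded_measurable g ->
  bounded_measurable (fun x => f x + g x).
Proof.
move=> [mf [M fM]] [mg [N gN]]; split; first exact: measurable_funD.
by exists (M + N) => x; rewrite (le_trans (ler_normD _ _))// lerD.
Qed.

Lemma bounded_measurableZ r f : bounded_measurable f ->
  bounded_measurable (fun x => r * f x).
Proof.
move=> [mf [M fM]]; split; first exact: measurable_funM.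
by exists (`|r| * M) => x; rewrite normrM ler_wpM2l.
Qed.

Lemma bounded_measurable_sum (I : Type) (s : seq I) (Q : pred I)
    (f : I -> T -> R) : (forall i, bounded_measurable (f i)) ->
  bounded_measurable (fun x => \sum_(i <- s | Q i) f i x).
Proof.
move=> bf; elim: s => [|i s ih].
  by under eq_fun do rewrite big_nil; exact: (bounded_measurable_cst 0).
under eq_fun do rewrite big_cons.
by case: (Q i) => //; exact: bounded_measurableD.
Qed.

Lemma Rintegral_indic p A : measurable A ->
  \int[p]_(x in setT) \1_A x = mass p A.
Proof. by move=> mA; rewrite /Rintegral integral_indic// setIT. Qed.

Lemma Rintegral_probability_cst p r : \int[p]_(x in setT) r = r.
Proof. by rewrite Rintegral_cst// [fine _](massT p) mulr1. Qed.

Lemma bounded_Rintegral_sum p (I : Type) (s : seq I) (Q : pred I)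
    (f : I -> T -> R) : (forall i, bounded_measurable (f i)) ->
  \int[p]_(x in setT) (\sum_(i <- s | Q i) f i x) =
  \sum_(i <- s | Q i) \int[p]_(x in setT) f i x.
Proof.
move=> bf; elim: s => [|i s ih].
  rewrite big_nil; under eq_Rintegral do rewrite big_nil.
  exact: Rintegral_probability_cst.
rewrite big_cons; under eq_Rintegral do rewrite big_cons.
case: ifP => // Qi; rewrite -ih -RintegralD//.
- exact: bounded_measurable_integrable.
- exact/bounded_measurable_integrable/bounded_measurable_sum.
Qed.

Lemma le_bounded_Rintegral p f g : bounded_measurable f ->
  bounded_measurable g -> (forall x, f x <= g x) ->
  \int[p]_(x in setT) f x <= \int[p]_(x in setT) g x.
Proof.
by move=> bf bg fg; apply: le_Rintegral => //;
  exact: bounded_measurable_integrable.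
Qed.

(** [s] is [c] times the number of multiples [c, 2c, ..., nc] strictly below [u]: the staircase of
    step [c] under [u]. *)
Lemma staircase_bounds (c u : R) n : 0 < c -> 0 <= u -> u <= n.+1%:R * c ->
  let s := \sum_(k < n) c * (k.+1%:R * c < u :> R)%R%:R in s <= u <= s + c.
Proof.
(* The induction also records the exact value of [s] when [u] exceeds [n%:R * c]; this is needed
   when the new term counts. *)
move=> c0 u0; suff : let s := \sum_(k < n) c * (k.+1%:R * c < u :> R)%R%:R in
    (n%:R * c < u -> s = n%:R * c) /\ (u <= n.+1%:R * c -> s <= u <= s + c).
  by case=> _; exact.
elim: n => [|n [ih1 ih2]]; rewrite ?big_ord0 ?big_ord_recr/=.
  by split; [rewrite mul0r|rewrite mul1r add0r u0].
have [nu|un] := ltP (n.+1%:R * c) u; last first.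
  by rewrite mulr0 addr0; split => [//|_]; exact: ih2.
have nn : n%:R * c <= n.+1%:R * c by rewrite ler_pM2r// ler_nat.
rewrite ih1 ?(le_lt_trans nn)// mulr1.
have -> : n%:R * c + c = n.+1%:R * c by rewrite -natr1 mulrDl mul1r.
split => // un; rewrite (ltW nu)/= (le_trans un)//.
by rewrite -[in leLHS]natr1 mulrDl mul1r.
Qed.

(** The pointwise staircase bounds are integrated; the error stays [c] because [p] has total mass
    1. *)
Lemma Rintegral_staircase p (f : T -> R) (c : R) n : 0 < c ->
  measurable_fun setT f -> (forall x, 0 <= f x <= n.+1%:R * c) ->
  let s := \sum_(k < n) c * mass p [set x | k.+1%:R * c < f x] in
  s <= \int[p]_(x in setT) f x <= s + c.
Proof.
move=> c0 mf f01.
pose S k : set T := [set x | k.+1%:R * c < f x].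
have mS k : measurable (S k).
  rewrite -[S k]setTI; have -> : S k = f @^-1` `]k.+1%:R * c, +oo[.
    by apply/seteqP; split => x; rewrite /S/= in_itv/= andbT.
  exact: mf.
pose t k x : R := c * \1_(S k) x.
have bt k : bounded_measurable (t k).
  by apply: bounded_measurableZ; exact: bounded_measurable_indic.
have bst : bounded_measurable (fun x => \sum_(k < n) t k x).
  by apply: (@bounded_measurable_sum _ _ _ (fun k : 'I_n => t k)).
have bf : bounded_measurable f.
  split => //; exists (n.+1%:R * c) => x; have /andP[f0 f1] := f01 x.
  by rewrite ger0_norm.
have -> : \sum_(k < n) c * mass p [set x | k.+1%:R * c < f x] =
    \int[p]_(x in setT) (\sum_(k < n) t k x).
  rewrite (@bounded_Rintegral_sum p _ _ _ (fun k : 'I_n => t k))//.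
  apply: eq_bigr => k _.
  rewrite RintegralZl//; last first.
    exact/bounded_measurable_integrable/bounded_measurable_indic.
  by rewrite Rintegral_indic.
have st x : \sum_(k < n) t k x <= f x <= \sum_(k < n) t k x + c.
  have /andP[f0 f1] := f01 x; have := staircase_bounds c0 f0 f1.
  rewrite /= (eq_bigr (fun k : 'I_n => t k x))// => k _.
  rewrite /t indicE; have [h|h] := ltP; first by rewrite mem_set.
  by rewrite memNset//; apply/negP; rewrite -leNgt.
apply/andP; split.
  by apply: le_bounded_Rintegral => // x; case/andP: (st x).
rewrite -[X in _ + X](Rintegral_probability_cst p) -RintegralD//.
- apply: le_bounded_Rintegral => // [|x]; last by case/andP: (st x).
  exact: bounded_measurableD (bounded_measurable_cst _).
- exact: bounded_measurable_integrable.
- exact/bounded_measurable_integrable/bounded_measurable_cst.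
Qed.

End bounded_measurable.

Lemma continuous_borel_measurable (R : realType) (T : ptopologicalType)
    (h : T -> R) : continuous h -> measurable_fun setT (h : borel T -> R).
Proof.
move=> /continuousP ch; apply: (measurability _ (RGenOpens.measurableE R)).
move=> _ [_ [a [b ->] <-]]; rewrite setTI; apply: open_measurable_borel.
exact/ch/interval_open.
Qed.

(** * Stability of countable unions of closed sets *)

Section Fsigma.
Context (T : ptopologicalType).

Lemma Fsigma_bigcup (U : (set T)^nat) : (forall n, Fsigma (U n)) ->
  Fsigma (\bigcup_n U n).
Proof.
move=> fU; have /choice[F FP] n : exists F : (set T)^nat,
    (forall k, closed (F k)) /\ U n = \bigcup_k F k.
  by have [F ? ?] := fU n; exists F.
exists (fun m => if unpickle m is Some p then F p.1 p.2 else set0).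
  by move=> m; case: unpickle => [p|]; [case: (FP p.1)|exact: closed0].
apply/seteqP; split=> [t [n _]|t [m _]].
  case: (FP n) => _ -> [k _ tF]; exists (pickle (n, k)) => //.
  by rewrite pickleK.
case: unpickle => // p tF; exists p.1 => //; case: (FP p.1) => _ ->.
by exists p.2.
Qed.

Lemma FsigmaI (A B : set T) : Fsigma A -> Fsigma B ->
  Fsigma (A `&` B).
Proof.
move=> [F cF ->] [G cG ->]; rewrite setI_bigcupl.
apply: Fsigma_bigcup => n; exists (fun m => F n `&` G m).
  by move=> m; exact: closedI.
by rewrite setI_bigcupr.
Qed.

Lemma FsigmaT : Fsigma [set: T].
Proof.
exists (fun=> setT); first by move=> _; exact: closedT.
by rewrite bigcup_const//; exists 0%N.
Qed.

Lemma Fsigma_gt (R : realType) (f : T -> R) (q : R) : continuous f ->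
  Fsigma [set x | q < f x].
Proof.
move=> cf; exists (fun n => f @^-1` [set r | q + n.+1%:R^-1 <= r]).
  by move=> n; apply: (closed_comp _ (@closed_ge _ _)) => v _; exact: cf.
apply/seteqP; split=> [x /= qx|x [n _ /= hn]].
  have [n hn] := natSinv_lt (ltac:(by rewrite subr_gt0) : 0 < f x - q).
  by exists n => //=; rewrite -lerBrDl ltW.
by apply: lt_le_trans hn; rewrite ltrDl invr_gt0.
Qed.

End Fsigma.

Section weak_star.
Context (R : realType) (V : ptopologicalType).
Implicit Types (x y : pmeasure R V) (h : bounded_continuous R V) (U : set V).

Lemma bounded_continuous_measurable h :
  bounded_measurable (sval h : borel V -> R).
Proof.
case: h => h [/= ch [M [_ hM]]]; split; first exact: continuous_borel_measurable.
by exists (M + 1) => v; apply: hM => //; rewrite ltrDl.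
Qed.

Lemma integral_against_continuous h :
  continuous (integral_against h : pmeasure R V -> R).
Proof.
move=> x; have /cvg_sup/(_ h) hx : nbhs x --> (x : weak_star R V).
  exact: cvg_id.
by move=> A /initial_continuous/hx.
Qed.

Lemma weak_star_cvg (F : set_system (pmeasure R V)) x : Filter F ->
  (forall h, integral_against h y @[y --> F] --> integral_against h x) ->
  F --> x.
Proof.
move=> FF Fh; apply/cvg_sup => h A /= [_ [[B oB <-] Bx BA]].
by apply: filterS BA _; apply: Fh; exact: open_nbhs_nbhs.
Qed.

(* Layer-cake approximation of h by finitely many indicators of open sets. *)
Lemma integral_against_lsc (F : set_system (pmeasure R V)) x : Filter F ->
  (forall U e, open U -> 0 < e ->
    F [set y : pmeasure R V | mass x U - e < mass y U]) ->
  forall h e, 0 < e ->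
    F [set y | integral_against h x - e < integral_against h y].
Proof.
move=> FF FU h e e0.
have bh := bounded_continuous_measurable h; have [mh [M0 hM0]] := bh.
pose M : R := `|M0| + 1; have M_gt0 : 0 < M by rewrite ltr_pwDr.
have hM v : `|sval h v| <= M.
  by rewrite (le_trans (hM0 v))// (le_trans (ler_norm _))// lerDl.
(* The shift brings the values between 0 and [2 * M], where the staircase estimate applies. *)
pose u v := sval h v + M.
have [n ne] : exists n, n.+1%:R^-1 < e / 2 / (2 * M).
  by apply: natSinv_lt; rewrite !divr_gt0 ?mulr_gt0.
pose c : R := 2 * M / n.+1%:R; have c0 : 0 < c by rewrite divr_gt0 ?mulr_gt0.
have nc : n.+1%:R * c = 2 * M by rewrite /c mulrC divfK.
have ce : c < e / 2 by rewrite /c mulrC -ltr_pdivlMr// mulr_gt0.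
have mu_ : measurable_fun setT (u : borel V -> R).
  by apply: measurable_funD => //; exact: measurable_cst.
have u0 v : 0 <= u v <= n.+1%:R * c.
  by rewrite nc /u; have := hM v; rewrite ler_norml => /andP[]; lra.
have uE y : \int[y]_(v in [set: borel V]) u v = integral_against h y + M.
  rewrite /u RintegralD//; first by rewrite Rintegral_probability_cst.
    exact: bounded_measurable_integrable.
  exact/bounded_measurable_integrable/bounded_measurable_cst.
pose S (k : nat) := [set v | k.+1%:R * c < u v].
have cu : continuous u.
  by move=> v; apply: cvgD; [case: (svalP h) => ch _; exact: ch|exact: cvg_cst].
have oS k : open (S k).
  rewrite (_ : S k = u @^-1` [set r | k.+1%:R * c < r])//.
  by apply: open_comp (@open_gt _ _) => v _; exact: cu.
(* A loss of [e'] on each of the [n] level sets costs [n%:R * (c * e')], at most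
   [2 * M * e' = e / 2]; the staircase error [c < e / 2] fits in the other half. *)
pose e' : R := e / 2 / (2 * M).
have e'0 : 0 < e' by rewrite !divr_gt0 ?mulr_gt0.
have FS : F [set y : pmeasure R V | forall k : 'I_n,
    mass x (S k) - e' < mass y (S k)].
  by apply: filter_forall => k; apply: FU.
apply: filterS FS => y /= Sy.
have /andP[_ xs] := Rintegral_staircase x c0 mu_ u0.
have /andP[ys _] := Rintegral_staircase y c0 mu_ u0.
have Sxy : \sum_(k < n) c * mass x (S k) - n%:R * (c * e') <=
    \sum_(k < n) c * mass y (S k).
  have -> : n%:R * (c * e') = \sum_(k < n) c * e'.
    by rewrite sumr_const card_ord mulr_natl.
  rewrite -sumrB; apply: ler_sum => k _.
  by rewrite -mulrBr ler_pM2l// ltW.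
have nce : n%:R * (c * e') <= e / 2.
  apply: (@le_trans _ _ (n.+1%:R * (c * e'))).
    by apply: ler_wpM2r; rewrite ?ler_nat// mulr_ge0// ltW.
  by rewrite mulrA nc /e' mulrC divfK// gt_eqF// mulr_gt0.
rewrite !uE in xs ys; lra.
Qed.

(** Portmanteau criterion: the one-sided estimate, applied to [h] and to [- h], becomes convergence
    of the integrals. *)
Lemma weak_star_cvg_open (F : set_system (pmeasure R V)) x : Filter F ->
  (forall U e, open U -> 0 < e ->
    F [set y : pmeasure R V | mass x U - e < mass y U]) ->
  F --> x.
Proof.
move=> FF FU; apply: weak_star_cvg => h; apply/cvgrPdist_lt => e e0.
have [ch [M [Mr hM]]] := svalP h.
have hN : continuous (- sval h) /\ bounded_fun (- sval h).
  split; first by move=> v; apply: cvgN; exact: ch.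
  exists M; split => // N MN v _; rewrite /= [X in `|X|](_ : _ = - sval h v)//.
  by rewrite normrN; exact: hM.
have hNE y : integral_against (exist _ _ hN) y = - integral_against h y.
  rewrite -[RHS]mulN1r /integral_against.
  have ih := bounded_measurable_integrable y (bounded_continuous_measurable h).
  rewrite -(@RintegralZl _ (borel V) _ y setT (sval h) (-1) measurableT ih).
  by apply: eq_Rintegral => v _; rewrite mulN1r.
apply: filterS2 (integral_against_lsc FF FU h e0)
  (integral_against_lsc FF FU (exist _ _ hN) e0) => y /=.
rewrite !hNE => h1 h2; rewrite ltr_norml; lra.
Qed.

Hypothesis cozeroV : forall U, open U -> exists h : V -> R,
  [/\ continuous h, forall v, 0 <= h v <= 1 & forall v, U v <-> 0 < h v].

(** The functions [f n] equal 1 on [G n] and vanish off [U], so their integrals lie between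
    [mass x (G n)] and [mass x U], and the [G n] exhaust [U]. This form of the set shows at once
    that it is open and that it is F_sigma. *)
Lemma mass_gt_bigcup U (q : R) : open U ->
  exists f : nat -> bounded_continuous R V,
    [set x : pmeasure R V | q < mass x U] =
    \bigcup_n [set x : pmeasure R V | q < integral_against (f n) x].
Proof.
move=> oU; have [g [cg g01 gU]] := cozeroV oU.
pose f n v := Num.min 1 (n.+1%:R * g v).
have f01 n v : 0 <= f n v <= 1.
  rewrite le_min ler01 ge_min lexx andbT/= mulr_ge0//.
  by case/andP: (g01 v).
have fP n : continuous (f n) /\ bounded_fun (f n).
  split=> [v|].
    apply: (@continuous_min _ _ (cst 1) (fun v => n.+1%:R * g v)).
      exact: cst_continuous.
    by apply: cvgM; [exact: cvg_cst|exact: cg].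
  exists 1; split=> [|M M1 v _]; first exact: num_real.
  have /andP[f0 f1] := f01 n v.
  by rewrite /= ger0_norm// (le_trans f1)// ltW.
pose bc n : bounded_continuous R V := exist _ (f n) (fP n).
exists bc.
have bf n : bounded_measurable (f n : borel V -> R).
  exact: (bounded_continuous_measurable (bc n)).
pose G n := [set v | n.+1%:R^-1 < g v].
have oG n : open (G n).
  apply: (@open_comp _ _ g [set r | n.+1%:R^-1 < r]); last exact: open_gt.
  by move=> v _; exact: cg.
have mG n := open_measurable_borel (oG n).
have ndG : nondecreasing_seq G.
  move=> m n mn; apply/subsetPset => v /=; apply: le_lt_trans.
  by rewrite lef_pV2 ?posrE// ler_nat.
have GU : \bigcup_n G n = U.
  apply/seteqP; split=> [v [n _ /= gn]|v /gU/natSinv_lt[n gn]]; last first.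
    by exists n.
  by apply/gU; apply: le_lt_trans gn; rewrite invr_ge0.
apply/seteqP; split=> [x /= qx|x [n _ /= qx]].
  have := mass_nondecreasing_cvg (p := x) mG ndG; rewrite GU.
  move=> /cvgr_gt/(_ _ qx)[n _ /(_ n (leqnn n))/= qn]; exists n => //=.
  apply: lt_le_trans qn _; rewrite -Rintegral_indic//.
  apply: le_bounded_Rintegral => //; first exact: bounded_measurable_indic.
    exact: bounded_continuous_measurable.
  move=> v; rewrite [leRHS]/(f n v) indicE; have [Gv|nGv] := pselect (G n v).
    rewrite mem_set// /f le_min lexx/= -ler_pdivrMl// mulr1.
    exact: ltW.
  by rewrite memNset//; case/andP: (f01 n v).
have mU := open_measurable_borel oU.
apply: lt_le_trans qx _; rewrite -(Rintegral_indic x mU).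
apply: (le_bounded_Rintegral x (bf n) (bounded_measurable_indic R mU)).
move=> v; rewrite indicE; have [Uv|nUv] := pselect (U v).
  by rewrite mem_set//; case/andP: (f01 n v).
rewrite memNset// /f ge_min; apply/orP; right.
apply: mulr_ge0_le0; first exact: ler0n.
rewrite leNgt; apply/negP => gv.
by apply: nUv; apply/gU.
Qed.

Lemma open_mass_gt U (q : R) : open U ->
  open [set x : pmeasure R V | q < mass x U].
Proof.
move=> /(mass_gt_bigcup q)[f ->]; apply: bigcup_open => n _.
apply: (@open_comp _ _ (integral_against (f n)) [set r | q < r]) (@open_gt _ _).
by move=> x _; exact: integral_against_continuous.
Qed.

Lemma Fsigma_mass_gt U (q : R) : open U ->
  Fsigma [set x : pmeasure R V | q < mass x U].
Proof.
move=> /(mass_gt_bigcup q)[f ->]; apply: Fsigma_bigcup => n.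
by apply: Fsigma_gt; exact: integral_against_continuous.
Qed.

(** Dynkin induction from the open sets [U], for which the sets [[set x | q < mass x U]] are weak*
    open. *)
Lemma measurable_mass (A : set (borel V)) : measurable A ->
  measurable_fun setT (fun x : borel (pmeasure R V) => mass (x : pmeasure R V) A).
Proof.
pose P (A : set (borel V)) := measurable_fun setT
  (fun x : borel (pmeasure R V) => mass (x : pmeasure R V) A).
move: A; apply: (@dynkin_induction _ (borel V) (@open V) P) => //; rewrite /P.
- exact: openI.
- under eq_fun do rewrite massT; exact: measurable_cst.
- move=> U oU; apply: (measurability _ (RGenOInfty.measurableE R)).
  move=> _ [_ [q ->] <-]; rewrite setTI.
  rewrite (_ : _ @^-1` _ = [set x : pmeasure R V | q < mass x U]).
    by apply: (@open_measurable_borel (pmeasure R V)); exact: open_mass_gt.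
  by apply/seteqP; split => x; rewrite /= in_itv/= andbT.
- move=> S mS mf; under eq_fun do rewrite massC//.
  by apply: measurable_funB => //; exact: measurable_cst.
move=> F mF tF mf.
apply: (@measurable_fun_cvg _ _ _ _
  (fun n (x : borel (pmeasure R V)) =>
    \sum_(i < n) mass (x : pmeasure R V) (F i))).
  by move=> n; apply: measurable_sum => i.
move=> x _; rewrite [X in X @ _ --> _](_ : _ =
    fun n => fine (\sum_(0 <= i < n) (x : pmeasure R V) (F i))%E).
  apply: fine_cvg; rewrite -massE; last exact: bigcupT_measurable.
  by apply: measure_semi_sigma_additive => //; exact: bigcupT_measurable.
apply/funext => n; rewrite big_mkord -sum_fine// => i _.
exact: fin_num_measure.
Qed.

End weak_star.

(** * Ultralimits and tightness of random measures *)

Lemma ultra_bounded_cvg (R : realType) (T : Type) (F : set_system T)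
    (f : T -> R) : UltraFilter F -> (forall t, 0 <= f t <= 1) ->
  exists l : R, f t @[t --> F] --> l.
Proof.
move=> uF f01; have [l [_ cl]] : (`[0, 1]%classic : set R) `&` cluster (f @ F) !=set0.
  have := @segment_compact R 0 1; apply.
  by apply: (@filterE _ F) => t; rewrite /= in_itv/=; exact: f01.
exists l => B lB; have [//|FB] := in_ultra_setVsetC (f @^-1` B) uF.
by have [r []] := cl (~` B) B FB lB.
Qed.

(** Otherwise points chosen in the finite intersections would cluster in the compact [K 0], and the
    cluster point would lie in every closed [K k]. The bound [N] is uniform in [t]. *)
Lemma compact_bigcap_set0 (T : topologicalType) (K : (set T)^nat) :
  compact (K 0%N) -> (forall n, closed (K n)) -> \bigcap_n K n = set0 ->
  exists N, forall t, exists2 k, (k <= N)%N & ~ K k t.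
Proof.
move=> kK cK K0; apply: contrapT => /forallNP nK.
have /choice[u uP] N : exists t, forall k, (k <= N)%N -> K k t.
  have /existsNP[t /forall2NP tP] := nK N.
  by exists t => k kN; have [//|/contrapT] := tP k.
have [|p [Kp up]] := kK (u @ \oo) _.
  by exists 0%N => // n _ /=; exact: uP.
suff : (\bigcap_n K n) p by rewrite K0.
move=> k _; apply: cK => B pB; have := up (K k) B _ pB; apply.
by exists k => // n /= kn; exact: uP.
Qed.

(** Finite sequences over a countable type are countable, so an open set is a countable union of the
    boxes inside it. This serves properties, such as being F_sigma or measurable, that are only
    stable under countable unions. *)
Lemma countable_subbase_ind (T : topologicalType) (C : countType)
    (S : C -> set T) (P : set (set T)) :
  (forall W x, open W -> W x -> exists s : seq C,
    (forall c, c \in s -> S c x) /\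
    forall y, (forall c, c \in s -> S c y) -> W y) ->
  P set0 -> P setT -> setI_closed P ->
  (forall W : (set T)^nat, (forall n, P (W n)) -> P (\bigcup_n W n)) ->
  (forall c, P (S c)) -> forall W, open W -> P W.
Proof.
move=> SW P0 PT PI Pbig PS W oW.
pose box (s : seq C) : set T := [set x | forall c, c \in s -> S c x].
have Pbox s : P (box s).
  elim: s => [|c s ih]; first by rewrite (_ : box [::] = setT)// -subTset.
  rewrite (_ : box _ = S c `&` box s); first exact: PI.
  apply/seteqP; split=> [x xs|x [xc xs] r].
    split; first by apply: xs; rewrite mem_head.
    by move=> r rs; apply: xs; rewrite in_cons rs orbT.
  by rewrite in_cons => /predU1P[->//|]; exact: xs.
(* Boxes not inside [W] and numbers coding no sequence contribute the empty set, hence the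
   assumption [P set0]. *)
pose B n := if unpickle n is Some s then
  (if `[< box s `<=` W >] then box s else set0) else set0.
have -> : W = \bigcup_n B n.
  apply/seteqP; split=> [x Wx|x [n _]].
    have [s [sx sW]] := SW _ _ oW Wx.
    by exists (pickle s) => //; rewrite /B pickleK asboolT.
  by rewrite /B; case: unpickle => // s; case: asboolP => // h /h.
apply: Pbig => n; rewrite /B; case: unpickle => // s.
by case: ifP.
Qed.

Section inner_base.
Context (V : ptopologicalType) (b : nat -> set V).
Hypothesis ob : forall n, open (b n).
Hypothesis bP : forall U x, open U -> U x -> exists n, b n x /\ b n `<=` U.

Lemma base_exhaustion (G : set (set V)) U : is_algebra G ->
  (forall n, G (b n)) -> open U -> exists W : (set V)^nat,
  [/\ forall n, G (W n), forall n, open (W n), nondecreasing_seq W &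
      \bigcup_n W n = U].
Proof.
move=> aG Gb oU; pose c i := if `[< b i `<=` U >] then b i else set0.
have Gc i : G (c i) by rewrite /c; case: ifP => // _; exact: algebra0.
have oc i : open (c i) by rewrite /c; case: ifP => // _; exact: open0.
exists (fun n => \big[setU/set0]_(i < n.+1) c i); split.
- by move=> n; exact: (algebra_bigU aG).
- by move=> n; elim/big_ind : _ => //; [exact: open0|exact: openU].
- by move=> m n mn; apply/subsetPset; exact: subset_bigsetU.
rewrite bigcup_bigsetU_bigcup; apply/seteqP; split=> [x [i _]|x Ux].
  by rewrite /c; case: asboolP => // h /h.
by have [n [bx bU]] := bP oU Ux; exists n => //; rewrite /c asboolT.
Qed.

Lemma base_open_sub_sigma (G : set (set V)) : is_algebra G ->
  (forall n, G (b n)) -> open `<=` <<s G >>.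
Proof.
move=> aG Gb U oU; have [W [GW _ _ <-]] := base_exhaustion aG Gb oU.
by apply: sigma_algebra_bigcup => n; exact: sub_sigma_algebra.
Qed.

(** An open [U] is exhausted from inside by open members [W n] of [G]. A lower bound on
    [mass y (W n)] is one on [mass y U], and replacing [U] by [W n] at [x] costs half of [e]. *)
Lemma weak_star_cvg_base (R : realType) (F : set_system (pmeasure R V))
    (x : pmeasure R V) (G : set (set V)) : Filter F -> is_algebra G ->
  (forall n, G (b n)) ->
  (forall U e, G U -> open U -> 0 < e ->
    F [set y : pmeasure R V | mass x U - e < mass y U]) -> F --> x.
Proof.
move=> FF aG Gb FU; apply: weak_star_cvg_open => U e oU e0.
have [W [GW oW ndW WU]] := base_exhaustion aG Gb oU.
have mW n := open_measurable_borel (oW n).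
have := mass_nondecreasing_cvg (p := x) mW ndW; rewrite WU.
have e20 : 0 < e / 2 by rewrite divr_gt0.
move=> /cvgrPdist_lt/(_ _ e20)[n _ /(_ n (leqnn n))/= ne].
apply: filterS (FU _ _ (GW n) (oW n) e20) => y /= xy.
have : mass y (W n) <= mass y U.
  apply: le_mass => //; first exact: open_measurable_borel.
  by rewrite -WU; exact: bigcup_sup.
by move: ne; rewrite ltr_norml => /andP[_]; lra.
Qed.

End inner_base.

(** Off the measurable sets the value is 0 by normalisation; thus ultralimits of [mass y A] exist
    for every [A]. *)
Lemma pmeasure_mass01 (R : realType) (V : ptopologicalType) (x : pmeasure R V)
  (A : set (borel V)) : 0 <= mass x A <= 1.
Proof.
rewrite mass_ge0/=; have [mA|nA] := pselect (measurable A); first exact: mass_le1.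
by rewrite /mass [X in fine X](set_mem (valP x) A nA).
Qed.

Lemma mass_normalise (R : realType) (V : ptopologicalType)
  (p : probability (borel V) R) (A : set (borel V)) : measurable A ->
  mass (normalise p) A = mass p A.
Proof. by move=> mA; rewrite /mass /= /off_measurable0 asboolT. Qed.

Section ultralimit.
Context (R : realType) (V : ptopologicalType).
Context (G : set (set V)) (F : set_system (pmeasure R V)) (uF : UltraFilter F).
Hypothesis aG : is_algebra G.
Hypothesis mG : forall A, G A -> measurable (A : set (borel V)).
Hypothesis oG : open `<=` <<s G >>.
Hypothesis GK : forall A (e : R), G A -> 0 < e -> exists K : set V,
  [/\ compact K, closed K, K `<=` A &
      F [set x : pmeasure R V | mass x (A `\` K) <= e]].

(* Compact class argument: the limit of y(A) along F is continuous at the empty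
   set because a decreasing sequence of compact approximations with empty
   intersection has a finite subfamily with empty intersection. *)
Lemma ultralimit : exists x : pmeasure R V, forall A, G A ->
  mass (y : pmeasure R V) A @[y --> F] --> mass x A.
Proof.
have /choice[nu nuP] A : exists l : R, mass (y : pmeasure R V) A @[y --> F] --> l.
  by apply: ultra_bounded_cvg => y; exact: pmeasure_mass01.
have nu_unique A l : mass (y : pmeasure R V) A @[y --> F] --> l -> nu A = l.
  by move=> yl; exact: (cvg_unique (@Rhausdorff R) (nuP A) yl).
have nu_ge0 A : 0 <= nu A.
  apply: (cvgr_to_ge (nuP A)); apply: nearW => y; exact: mass_ge0.
have nuT : nu setT = 1.
  by apply: nu_unique; under eq_fun do rewrite massT; exact: cvg_cst.
have nuU A B : G A -> G B -> A `&` B = set0 -> nu (A `|` B) = nu A + nu B.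
  move=> GA GB AB; apply: nu_unique.
  under eq_fun => y do rewrite (massU y (mG GA) (mG GB) AB).
  by apply: cvgD; exact: nuP.
have nu_cvg0 (H : (set V)^nat) : (forall n, G (H n)) -> nonincreasing_seq H ->
    \bigcap_n H n = set0 -> forall e : R, 0 < e -> exists n, nu (H n) < e.
  move=> GH niH H0 e e0.
  have w0 n : 0 < e / 2 / 2 ^+ n.+1 by rewrite !divr_gt0// exprn_gt0.
  have /choice[K KP] n := GK (GH n) (w0 n).
  have [|||N NP] := @compact_bigcap_set0 _ K.
  - by case: (KP 0%N).
  - by move=> n; case: (KP n).
  - rewrite -subset0 -H0 => t Kt n _; case: (KP n) => _ _ + _; apply.
    exact: Kt.
  exists N; apply: (@le_lt_trans _ _ (e / 2)); last first.
    by rewrite ltr_pdivrMr// ltr_pMr// ltr1n.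
  apply: (cvgr_to_le (nuP (H N))).
  have FK : F [set x : pmeasure R V | forall k : 'I_N.+1,
      mass x (H k `\` K k) <= e / 2 / 2 ^+ k.+1].
    by apply: filter_forall => k; case: (KP k).
  apply: filterS FK => y /= yK.
  have mHK k : measurable (H k `\` K k : set (borel V)).
    apply: measurableD; first exact: mG.
    by apply: closed_measurable_borel; case: (KP k).
  (* A point of [H N] misses some [K k] with [k <= N] and lies in [H k] by monotonicity. The defects
     then sum to at most [e / 2]. *)
  have HN : H N `<=` \big[setU/set0]_(k < N.+1) (H k `\` K k).
    move=> t Ht; have [k kN nKt] := NP t.
    rewrite -(bigcup_mkord _ (fun k => H k `\` K k)); exists k => //=; split => //.
    by move: t Ht nKt => t Ht _; move: Ht; apply/subsetPset/niH.
  apply: le_trans (le_mass y _ _ HN) _; first exact: mG.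
    exact: bigsetU_measurable.
  apply: le_trans (mass_bigsetU_le y _ mHK) _.
  apply: le_trans (sum_halves_le N.+1 (ltW (divr_gt0 e0 (ltr0n _ 2)))).
  by apply: ler_sum => k _; exact: yK.
have [p pE] := caratheodory_extension aG nu_ge0 nuT nuU nu_cvg0 oG.
exists (normalise p) => A GA; rewrite mass_normalise; last exact: mG.
have -> : mass p A = nu A by rewrite /mass pE.
exact: nuP.
Qed.

End ultralimit.

(** * Weak* compact sets and the Radon property *)

Section random_measure.
Context (R : realType) (V : ptopologicalType).
Hypothesis polishV : polish R V.
Notation M := (pmeasure R V).

Lemma polish_algebra : exists b a : nat -> set V,
  [/\ forall n, open (b n),
      forall U x, open U -> U x -> exists n, b n x /\ b n `<=` U,
      is_algebra (range a), forall n, range a (b n) &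
      forall n, measurable (a n : set (borel V))].
Proof.
have [b [ob bP]] := polish_base polishV.
have [a [aG Gb aH]] := countable_algebra b.
exists b, a; split => //; apply: aH.
- by split=> [|A B|A]; [exact: measurable0|exact: measurableU|exact: measurableC].
- by move=> n; exact: open_measurable_borel.
Qed.

Lemma weak_star_open_ind (P : set (set M)) : P setT -> setI_closed P ->
  (forall W : (set M)^nat, (forall n, P (W n)) -> P (\bigcup_n W n)) ->
  (forall (U : set V) (q : R), open U -> P [set x : M | q < mass x U]) ->
  forall W, open W -> P W.
Proof.
move=> PT PI Pbig PU.
have [b [a [ob bP aG Gb _]]] := polish_algebra.
(* Indices whose [a p.1] is not open are sent to the whole space, where [P] holds by assumption. *)
pose S (p : nat * rat) : set M :=
  if `[< open (a p.1) >] then [set x : M | ratr p.2 < mass x (a p.1)] else setT.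
apply: (@countable_subbase_ind M _ S) => //; last 2 first.
- rewrite (_ : set0 = [set x : M | 2 < mass x [set: V]]); first exact/PU/openT.
  by apply/seteqP; split => x //=; rewrite massT; lra.
- by move=> p; rewrite /S; case: asboolP => //; exact: PU.
move=> W y oW; move: y; suff h (x : M) : W x -> exists s : seq (nat * rat),
  (forall c, c \in s -> S c x) /\ forall y, (forall c, c \in s -> S c y) -> W y.
  by [].
move=> Wx; pose box (s : seq (nat * rat)) : set M :=
  [set x : M | forall p, p \in s -> S p x].
(* By the portmanteau theorem the filter generated by the boxes around x
   converges to x, so that these boxes form a base of neighbourhoods. *)
pose F := filter_from [set s | box s x] box.
have FF : Filter F.
  apply: filter_from_filter; first by exists [::].
  move=> s t sx tx; exists (s ++ t).
    by move=> p; rewrite mem_cat => /orP[]; [exact: sx|exact: tx].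
  by move=> y yst; split=> p ps; apply: yst; rewrite mem_cat ps ?orbT.
have Fx : F --> (x : M).
  apply: (weak_star_cvg_base ob bP FF aG Gb) => _ e [i _ <-] oi e0.
  have [q] := rat_in_itvoo (ltac:(by rewrite ltrBlDr ltrDl) :
    mass x (a i) - e < mass x (a i)).
  rewrite in_itv/= => /andP[q1 q2].
  exists [:: (i, q)]; first by move=> p; rewrite inE => /eqP->; rewrite /S asboolT.
  move=> y /(_ (i, q) (mem_head _ _)); rewrite /S asboolT//=.
  exact: lt_trans.
have [s sx sW] := Fx _ (open_nbhs_nbhs (conj oW Wx)).
by exists s.
Qed.

Lemma weak_star_Fsigma (W : set M) : open W -> Fsigma W.
Proof.
apply: weak_star_open_ind; first exact: FsigmaT.
- by move=> A B; exact: FsigmaI.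
- exact: Fsigma_bigcup.
- by move=> U q; exact: (Fsigma_mass_gt (polish_cozero polishV)).
Qed.

Lemma closed_mass_le U (q : R) : open U -> closed [set x : M | mass x U <= q].
Proof.
move=> oU; rewrite -[X in closed X]setCK; apply: open_closedC.
rewrite (_ : ~` _ = [set x : M | q < mass x U]).
  exact: (open_mass_gt (polish_cozero polishV)).
by apply/seteqP; split => x /=; rewrite ltNge => /negP.
Qed.

(* The defect of K is measured in the open set O \ K rather than in a \ K: this
   makes the conditions closed for the weak* topology. *)
Lemma compact_mass_set (b a : nat -> set V) (K O : nat -> nat -> set V) :
  (forall n, open (b n)) ->
  (forall U x, open U -> U x -> exists n, b n x /\ b n `<=` U) ->
  is_algebra (range a) -> (forall n, range a (b n)) ->
  (forall n, measurable (a n : set (borel V))) ->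
  (forall i m, [/\ compact (K i m) /\ closed (K i m), open (O i m),
    K i m `<=` a i & a i `<=` O i m]) ->
  let X := [set x : M | forall i m, mass x (O i m `\` K i m) <= m.+1%:R^-1] in
  compact X /\ closed X.
Proof.
move=> ob bP aG Gb ma KO X.
have cX : closed X.
  rewrite (_ : X = \bigcap_i \bigcap_m
      [set x : M | mass x (O i m `\` K i m) <= m.+1%:R^-1]).
    apply: closed_bigI => i _; apply: closed_bigI => m _.
    apply: closed_mass_le; have [[_ cK] oO _ _] := KO i m.
    by rewrite setDE; apply: openI => //; exact: closed_openC.
  by apply/seteqP; split=> [x xX i _ m _|x xX i m]; [exact: xX|exact: xX].
split => //; rewrite compact_ultra => F uF FX.
have mG A : range a A -> measurable (A : set (borel V)).
  by move=> [n _ <-].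
have oG := base_open_sub_sigma ob bP aG Gb.
(* [F] contains [X], on which the defect of [K i m] in [a i] is at most [m.+1%:R^-1]; so the [K i m]
   are the required compact approximations. *)
have [|x xP] := ultralimit uF aG mG oG.
  move=> _ e [i _ <-] e0; have [m me] := natSinv_lt e0.
  have [[kK cK] oO Ka aO] := KO i m; exists (K i m); split => //.
  apply: filterS FX => x xX; apply: le_trans (ltW me); apply: le_trans (xX i m).
  apply: le_mass.
  - by apply: measurableD; [exact: ma|exact: closed_measurable_borel].
  - apply: measurableD; first exact: open_measurable_borel.
    exact: closed_measurable_borel.
  - by move=> v [/aO].
have Fx : F --> x.
  apply: (weak_star_cvg_base ob bP _ aG Gb) => A e GA _ e0.
  by apply: (cvgr_gt _ (xP A GA)); rewrite ltrBlDr ltrDl.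
exists x; split => //; apply: (@closed_cvg _ _ F _ id X) Fx => //.
Qed.

Variables (P : probability (borel M) R) (G : pmeasure R V).
Hypothesis mean : forall A : set (borel V), measurable A ->
  \int[P]_(x in [set: borel M]) mass (x : M) A = mass G A.

Lemma bounded_measurable_mass (A : set (borel V)) : measurable A ->
  bounded_measurable (fun x : borel M => mass (x : M) A).
Proof.
move=> mA; split; first exact: (measurable_mass (polish_cozero polishV)).
by exists 1 => x; have /andP[x0 x1] := pmeasure_mass01 x A; rewrite ger0_norm.
Qed.

Lemma measurable_mass_gt (A : set (borel V)) (r : R) : measurable A ->
  measurable ([set x : M | r < mass x A] : set (borel M)).
Proof.
move=> /bounded_measurable_mass[mA _].
rewrite -[X in measurable X]setTI (_ : [set x : M | _] =
  (fun x : borel M => mass (x : M) A) @^-1` `]r, +oo[); first exact: mA.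
by apply/seteqP; split => x; rewrite /= in_itv/= andbT.
Qed.

Lemma mean_markov (A : set (borel V)) (r : R) : measurable A -> 0 < r ->
  r * mass P [set x : M | r < mass x A] <= mass G A.
Proof.
move=> mA r0; have mS := measurable_mass_gt r mA.
rewrite -mean// -Rintegral_indic// -RintegralZl//; last first.
  exact/bounded_measurable_integrable/bounded_measurable_indic.
apply: le_bounded_Rintegral.
- exact/bounded_measurableZ/bounded_measurable_indic.
- exact: bounded_measurable_mass.
move=> x; rewrite indicE; have [xr|xr] := pselect (r < mass (x : M) A).
  by rewrite mem_set// mulr1 ltW.
by rewrite memNset// mulr0 mass_ge0.
Qed.

(** The complement of the compact set of [compact_mass_set] is a countable union of events, each
    bounded by Markov's inequality through the mean [G]. *)
Lemma random_measure_tight (e : R) : 0 < e ->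
  exists X : set M, [/\ compact X, closed X & mass P (~` X) <= e].
Proof.
move=> e0; have [b [a [ob bP aG Gb ma]]] := polish_algebra.
(* The division by [m.+1%:R] makes up for the threshold [m.+1%:R^-1] in Markov's inequality;
   [pickle] numbers the pairs for the geometric series. *)
pose w (i m : nat) : R := e / 2 ^+ (pickle (i, m)).+1 / m.+1%:R.
have w0 i m : 0 < w i m by rewrite !divr_gt0// exprn_gt0.
have /choice[KO KOP] (p : nat * nat) : exists KO : set V * set V,
    [/\ compact KO.1 /\ closed KO.1, open KO.2, KO.1 `<=` a p.1,
     a p.1 `<=` KO.2 & mass G (KO.2 `\` KO.1) <= w p.1 p.2].
  have [C [U CU]] := polish_regularity polishV G (ma p.1) (w0 p.1 p.2).
  by exists (C, U).
pose K i m := (KO (i, m)).1; pose O i m := (KO (i, m)).2.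
have KOP' i m : [/\ compact (K i m) /\ closed (K i m), open (O i m),
    K i m `<=` a i & a i `<=` O i m] by case: (KOP (i, m)).
have [kX cX] := compact_mass_set ob bP aG Gb ma KOP'.
eexists; split; [exact: kX|exact: cX|].
have mOK i m : measurable (O i m `\` K i m : set (borel V)).
  have [[_ cK] oO _ _] := KOP' i m.
  apply: measurableD; first exact: open_measurable_borel.
  exact: closed_measurable_borel.
(* [pickle_inv] decodes exact codes only, so a decoded pair has code [n] and its weight is the
   [n]-th one; other numbers give the empty set. *)
pose B n : set (borel M) := if @pickle_inv (nat * nat)%type n is Some p then
  [set x : M | p.2.+1%:R^-1 < mass x (O p.1 p.2 `\` K p.1 p.2)] else set0.
have mB n : measurable (B n).
  by rewrite /B; case: pickle_inv => [p|//]; exact: measurable_mass_gt.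
apply: (@le_trans _ _ (mass P (\bigcup_n B n))).
  apply: le_mass.
  - by apply: measurableC; exact: closed_measurable_borel.
  - exact: bigcupT_measurable.
  move=> x /existsNP[i /existsNP[m /negP]]; rewrite -ltNge => xim.
  by exists (pickle (i, m)) => //; rewrite /B pickleK_inv.
apply: mass_bigcup_le => //; first exact: ltW.
move=> n; rewrite /B.
case E : (@pickle_inv (nat * nat)%type n) => [[i m]|]; last first.
  by rewrite mass0 divr_ge0 ?exprn_ge0// ltW.
have nE : pickle (i, m) = n by have := @pickle_invK (nat * nat)%type n; rewrite E.
have m0 : (0 : R) < m.+1%:R^-1 by rewrite invr_gt0.
have := mean_markov (mOK i m) m0; rewrite mulrC ler_pdivrMr// => /le_trans; apply.
have [_ _ _ _ KOe] := KOP (i, m).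
by rewrite -ler_pdivlMr ?ltr0n// (le_trans KOe)// /w nE.
Qed.

(** A closed inner approximation, available because weak* open sets are F_sigma, is cut down by a
    compact set given by tightness. *)
Lemma random_measure_radon (B : set (borel M)) (e : R) : measurable B -> 0 < e ->
  exists X : set M, [/\ compact X, closed X, X `<=` B & mass P (B `\` X) <= e].
Proof.
move=> mB e0; have e20 : 0 < e / 2 by rewrite divr_gt0.
have [C [cC CB BC]] := closed_regularity weak_star_Fsigma P mB e20.
have [X [kX cX PX]] := random_measure_tight e20.
have mC := closed_measurable_borel cC; have mX := closed_measurable_borel cX.
exists (C `&` X); split.
- by rewrite setIC; exact: compact_closedI.
- exact: closedI.
- by move=> x [/CB].
have h : B `\` (C `&` X) `<=` (B `\` C) `|` ~` X.
  move=> x [Bx nCX]; have [Cx|nCx] := pselect (C x); last by left.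
  by right=> Xx; exact: nCX.
apply: le_trans (le_mass P _ _ h) _.
- by apply: measurableD => //; exact: measurableI.
- by apply: measurableU; [exact: measurableD|exact: measurableC].
apply: le_trans (massU_le _ _ _) _; [exact: measurableD|exact: measurableC|].
by rewrite (splitr e) lerD.
Qed.

End random_measure.

(** * Partitions and simplices *)

Section refinement.
Context (V : ptopologicalType) (n : nat) (A : 'I_n -> set V).
Hypothesis mA : forall i, measurable (A i : set (borel V)).

(* The blocks of the refinement are the nonempty fibres of this map. *)
Let signature v : {set 'I_n} := [set i | `[< A i v >]]%SET.
Let atoms : {set {set 'I_n}} := [set e | `[< exists v, signature v = e >]]%SET.
Let atom (j : 'I_#|atoms|) : set V := signature @^-1` [set enum_val j].

Let signatureP i v : (i \in signature v) = `[< A i v >].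
Proof. by rewrite inE. Qed.

Let atom_measurable j : measurable (atom j : set (borel V)).
Proof.
rewrite (_ : atom j = \bigcap_(i in [set: 'I_n])
    (if i \in enum_val j then A i else ~` A i)); last first.
  apply/seteqP; split=> [v <- i _|v vj].
    by rewrite signatureP; case: asboolP.
  apply/setP => i; rewrite signatureP; apply/asboolP/idP.
    by move=> Aiv; have := vj i I; case: ifP => // _ /(_ Aiv).
  by move=> ij; have := vj i I; rewrite ij.
apply: fin_bigcap_measurable => // i _; case: ifP => _ //.
exact: measurableC.
Qed.

Let atom_nonempty j : atom j !=set0.
Proof.
have := enum_valP j; rewrite inE => /asboolP[v vj].
by exists v.
Qed.

Let atom_disjoint : trivIset setT atom.
Proof. by move=> i j _ _ [v [/= vi vj]]; apply: enum_val_inj; rewrite -vi -vj. Qed.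

Let atom_cover : \bigcup_j atom j = setT.
Proof.
rewrite -subTset => v _.
have va : signature v \in atoms by rewrite inE; apply/asboolP; exists v.
exists (enum_rank_in va (signature v)) => //.
by rewrite /atom /= enum_rankK_in.
Qed.

(** The sets [A i] may overlap or be empty; this is what reduces finitely many Borel sets to the
    blocks of one partition. *)
Lemma refinement : exists (J : fpartition V) (t : 'I_n -> {set 'I_(psize J)}),
  forall i, A i = \bigcup_(j in [set j | j \in t i]) block j.
Proof.
exists (FPartition atom_measurable atom_nonempty atom_disjoint atom_cover).
exists (fun i =>
  [set j : 'I_#|atoms| | i \in (enum_val j : {set 'I_n})]%SET) => i /=.
apply/seteqP; split=> [v Av|v [j /=]].
  have [j _ vj] : (\bigcup_j atom j) v by rewrite atom_cover.
  by exists j => //=; rewrite inE -vj signatureP; apply/asboolP.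
by rewrite inE => ij vj; apply/asboolP; rewrite -signatureP vj.
Qed.

End refinement.

Lemma common_refinement (V : ptopologicalType) (I J : fpartition V) :
  exists (L : fpartition V) (s : 'I_(psize I) -> {set 'I_(psize L)})
    (t : 'I_(psize J) -> {set 'I_(psize L)}), coarsening s /\ coarsening t.
Proof.
pose A (k : 'I_(psize I + psize J)) :=
  match fintype.split k with inl i => block i | inr j => block j end.
have mA k : measurable (A k : set (borel V)).
  by rewrite /A; case: fintype.split => ?; exact: block_measurable.
have [L [t tP]] := refinement mA.
exists L, (fun i => t (lshift _ i)), (fun j => t (rshift _ j)); split=> [i|j] /=;
  rewrite -tP /A.
  by rewrite (unsplitK (inl i)).
by rewrite (unsplitK (inr j)).
Qed.

(** Going through [refinement] covers the empty and the full set, for which [A] and its complement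
    do not form a partition into nonempty blocks. *)
Lemma partition_of_set (V : ptopologicalType) (A : set (borel V)) :
  measurable A -> exists (J : fpartition V) (t : {set 'I_(psize J)}),
    A = \bigcup_(j in [set j | j \in t]) block j.
Proof.
move=> mA; have [J [t tP]] := @refinement V 1 (fun=> A) (fun=> mA).
by exists J, (t ord0); exact: tP.
Qed.

Section evaluation.
Context (R : realType) (V : ptopologicalType).
Implicit Types (I J : fpartition V) (x : pmeasure R V).

Lemma mass_blocks (p : probability (borel V) R) J (t : {set 'I_(psize J)}) :
  mass p (\bigcup_(j in [set j | j \in t]) block j) =
  \sum_(j in t) mass p (block j).
Proof.
rewrite /mass sum_fine; last first.
  by move=> j _; apply: fin_num_measure; exact: block_measurable.
rewrite -(@measure_bigsetU_ord_cond _ R (borel V) p _ (mem t)).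
- rewrite -bigcup_seq_cond; congr (fine (p _)); apply: eq_bigcupl.
  by split=> j /=; rewrite mem_index_enum.
- by move=> j _; exact: block_measurable.
- by apply: sub_trivIset (@block_disjoint _ J).
Qed.

Lemma evaluationE I x i : simplex_val (evaluation I x) ord0 i = mass x (block i).
Proof. by rewrite /simplex_val /= mxE. Qed.

Lemma mass_evaluation x J (t : {set 'I_(psize J)}) :
  mass x (\bigcup_(j in [set j | j \in t]) block j) =
  \sum_(j in t) simplex_val (evaluation J x) ord0 j.
Proof. by rewrite mass_blocks; apply: eq_bigr => j _; rewrite evaluationE. Qed.

Lemma simplex_ext I (z w : simplex R I) :
  (forall i, simplex_val z ord0 i = simplex_val w ord0 i) -> z = w.
Proof. by move=> zw; apply: val_inj; apply/rowP => i; exact: zw. Qed.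

Lemma coarsenE I J (s : 'I_(psize I) -> {set 'I_(psize J)})
    (sIJ : coarsening s) (z : simplex R J) i :
  simplex_val (coarsen sIJ z) ord0 i = \sum_(j in s i) simplex_val z ord0 j.
Proof. by rewrite /simplex_val /= mxE. Qed.

Lemma coarsen_evaluation I J (s : 'I_(psize I) -> {set 'I_(psize J)})
    (sIJ : coarsening s) x : coarsen sIJ (evaluation J x) = evaluation I x.
Proof.
apply: simplex_ext => i; rewrite coarsenE evaluationE sIJ mass_blocks.
by apply: eq_bigr => j _; rewrite evaluationE.
Qed.

(* The preimage of z is the discrete measure with mass z_i at a point of block i. *)
Lemma evaluation_surjective I (z : simplex R I) : exists x, evaluation I x = z.
Proof.
have /choice[v vP] := @block_nonempty V I.
pose mu (A : set V) : R := \sum_i simplex_val z ord0 i * (v i \in A)%:R.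
have aT : is_algebra [set: set V] by [].
have mu0 A : 0 <= mu A.
  by apply: sumr_ge0 => i _; rewrite mulr_ge0// simplex_val_ge0.
have muT : mu setT = 1.
  by rewrite -(sum_simplex_val z); apply: eq_bigr => i _; rewrite in_setT mulr1.
have muU A B : [set: set V] A -> [set: set V] B -> A `&` B = set0 ->
    mu (A `|` B) = mu A + mu B.
  move=> _ _ AB; rewrite /mu -big_split/=; apply: eq_bigr => i _.
  rewrite -mulrDr in_setU -natrD; congr (_ * _%:R).
  have [iA|//] := boolP (v i \in A); have [iB|//] := boolP (v i \in B).
  have : (A `&` B) (v i) by split; exact: set_mem.
  by rewrite AB.
have mu_cvg0 (H : (set V)^nat) : (forall n, [set: set V] (H n)) ->
    nonincreasing_seq H -> \bigcap_n H n = set0 ->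
    forall e : R, 0 < e -> exists n, mu (H n) < e.
  move=> _ niH H0 e e0.
  have /choice[N NP] i : exists n, ~ H n (v i).
    apply/existsNP => Hv; have : (\bigcap_n H n) (v i) by move=> n _; exact: Hv.
    by rewrite H0.
  (* [mu] is carried by the finitely many points [v i], so from one common index on [H n] misses
     them all. *)
  exists (\max_i N i)%N; rewrite /mu big1// => i _.
  rewrite memNset ?mulr0// => Hi; apply: (NP i).
  by move: Hi; apply/subsetPset/niH; exact: leq_bigmax.
have oT : @open V `<=` <<s [set: set V] >> by move=> A _; exact: sub_sigma_algebra.
have [p pE] := caratheodory_extension aT mu0 muT muU mu_cvg0 oT.
exists (normalise p); apply: simplex_ext => i.
rewrite evaluationE mass_normalise; last exact: block_measurable.
rewrite /mass pE//= /mu (bigD1 i)//= mem_set// mulr1 big1 ?addr0// => j ji.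
rewrite memNset ?mulr0// => vij; move/eqP: ji; apply.
by apply: (@block_disjoint _ I) => //; exists (v j).
Qed.

End evaluation.

(** * Topology and Borel structure of the simplices *)

Section simplex_topology.
Context (R : realType) (V : ptopologicalType) (I : fpartition V).
Notation S := (simplex R I).

Lemma simplex_coord_continuous i :
  continuous (fun z : S => simplex_val z ord0 i).
Proof.
move=> z; apply: (@continuous_comp _ _ _ (@simplex_val R V I)
  (fun M : 'rV[R]_(psize I) => M ord0 i)).
  exact: initial_continuous.
exact: coord_continuous.
Qed.

(** The half-spaces that bound one coordinate by a rational form a countable subbase. *)
Lemma simplex_open_ind (P : set (set S)) : P setT -> setI_closed P ->
  (forall W : (set S)^nat, (forall n, P (W n)) -> P (\bigcup_n W n)) ->
  (forall i (q : R), P [set z : S | q < simplex_val z ord0 i]) ->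
  (forall i (q : R), P [set z : S | simplex_val z ord0 i < q]) ->
  forall W, open W -> P W.
Proof.
move=> PT PI Pbig Pgt Plt.
pose B (c : 'I_(psize I) * rat * bool) : set S :=
  if c.2 then [set z : S | ratr c.1.2 < simplex_val z ord0 c.1.1]
  else [set z : S | simplex_val z ord0 c.1.1 < ratr c.1.2].
apply: (@countable_subbase_ind S _ B) => //; last 2 first.
(* The empty set is written as an impossible half-space; an index [i] exists because some block
   contains [point]. *)
- have [i _ _] : (\bigcup_i block (f := I) i) point by rewrite block_cover.
  rewrite (_ : set0 = [set z : S | simplex_val z ord0 i < 0]) //.
  by apply/seteqP; split => z //=; rewrite ltNge simplex_val_ge0.
- by case=> [[i q] []]; [exact: Pgt|exact: Plt].
move=> W z [U oU <-] Uz.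
have /nbhs_ballP[e /= e0 zU] : nbhs (simplex_val z) U by exact: open_nbhs_nbhs.
have /choice[q qP] i : exists q : rat * rat,
    simplex_val z ord0 i - e < ratr q.1 < simplex_val z ord0 i /\
    simplex_val z ord0 i < ratr q.2 < simplex_val z ord0 i + e.
  have [|q1] := @rat_in_itvoo R (simplex_val z ord0 i - e) (simplex_val z ord0 i).
    by rewrite ltrBlDr ltrDl.
  have [|q2] := @rat_in_itvoo R (simplex_val z ord0 i) (simplex_val z ord0 i + e).
    by rewrite ltrDl.
  by rewrite !in_itv/= => h2 h1; exists (q1, q2).
exists ([seq (i, (q i).1, true) | i <- enum 'I_(psize I)] ++
        [seq (i, (q i).2, false) | i <- enum 'I_(psize I)]); split.
  move=> c; rewrite mem_cat => /orP[] /mapP[i _ ->]; rewrite /B/=.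
    by have [/andP[]] := qP i.
  by have [_ /andP[]] := qP i.
move=> y yP; apply: zU; split => // i j; rewrite ord1.
have := yP (j, (q j).1, true); have := yP (j, (q j).2, false).
rewrite !mem_cat /B/= => /(_ _)/wrap[|h2].
  by apply/orP; right; apply/mapP; exists j; rewrite ?mem_enum.
move=> /(_ _)/wrap[|h1].
  by apply/orP; left; apply/mapP; exists j; rewrite ?mem_enum.
rewrite /ball/= ltr_norml; have [/andP[a1 a2] /andP[b1 b2]] := qP j.
rewrite /simplex_val in h1 h2 a1 a2 b1 b2 *; lra.
Qed.

Lemma simplex_Fsigma (W : set S) : open W -> Fsigma W.
Proof.
apply: simplex_open_ind; first exact: FsigmaT.
- by move=> A B; exact: FsigmaI.
- exact: Fsigma_bigcup.
- by move=> i q; apply: Fsigma_gt; exact: simplex_coord_continuous.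
- move=> i q; rewrite (_ : [set z : S | _] =
    [set z : S | - q < - simplex_val z ord0 i]).
    apply: (@Fsigma_gt _ _ (fun z => - simplex_val z ord0 i)) => z.
    exact: (cvgN (@simplex_coord_continuous i z)).
  by apply/seteqP; split => z /=; rewrite ltrN2.
Qed.

Lemma measurable_simplex_coord i :
  measurable_fun setT (fun z : borel S => simplex_val (z : S) ord0 i).
Proof.
exact: (@continuous_borel_measurable R S _ (simplex_coord_continuous (i := i))).
Qed.

Lemma measurable_to_simplex d (T : measurableType d) (g : T -> S) :
  (forall i, measurable_fun setT (fun t => simplex_val (g t) ord0 i)) ->
  measurable_fun setT (g : T -> borel S).
Proof.
move=> mg; apply: (@measurability _ _ T (borel S) setT g (@open S)) => //.
move=> _ [W oW <-]; rewrite setTI; move: W oW; apply: simplex_open_ind.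
- by rewrite preimage_setT.
- by move=> A B; rewrite preimage_setI; exact: measurableI.
- by move=> W; rewrite preimage_bigcup; exact: bigcupT_measurable.
- move=> i q; rewrite (_ : _ @^-1` _ =
    (fun t => simplex_val (g t) ord0 i) @^-1` `]q, +oo[).
    by rewrite -[X in measurable X]setTI; exact: mg.
  by apply/seteqP; split => t; rewrite /= in_itv/= andbT.
- move=> i q; rewrite (_ : _ @^-1` _ =
    (fun t => simplex_val (g t) ord0 i) @^-1` `]-oo, q[).
    by rewrite -[X in measurable X]setTI; exact: mg.
  by apply/seteqP; split => t; rewrite /= in_itv/=.
Qed.

End simplex_topology.

Lemma bounded_measurable_blocks (R : realType) (V : ptopologicalType)
    (I : fpartition V) (t : {set 'I_(psize I)}) : bounded_measurable
  (fun z : borel (simplex R I) =>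
    \sum_(j in t) simplex_val (z : simplex R I) ord0 j).
Proof.
apply: (@bounded_measurable_sum _ (borel (simplex R I)) R _ _ (fun j => j \in t)
  (fun j (z : borel (simplex R I)) => simplex_val (z : simplex R I) ord0 j)) => i.
split; first exact: measurable_simplex_coord.
exists 1 => z; rewrite ger0_norm ?simplex_val_ge0//.
rewrite -(sum_simplex_val z) (bigD1 i)//= lerDl sumr_ge0// => j _.
exact: simplex_val_ge0.
Qed.

Lemma measurable_coarsen (R : realType) (V : ptopologicalType)
    (I J : fpartition V) (s : 'I_(psize I) -> {set 'I_(psize J)})
    (sIJ : coarsening s) : measurable_fun setT
  (coarsen sIJ : borel (simplex R J) -> borel (simplex R I)).
Proof.
apply: measurable_to_simplex => i; under eq_fun do rewrite coarsenE.
by case: (bounded_measurable_blocks R (s i)).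
Qed.

Lemma measurable_evaluation (R : realType) (V : ptopologicalType)
    (polishV : polish R V) (I : fpartition V) : measurable_fun setT
  (@evaluation R V I : borel (pmeasure R V) -> borel (simplex R I)).
Proof.
apply: measurable_to_simplex => i; under eq_fun do rewrite evaluationE.
by apply: (measurable_mass (polish_cozero polishV)); exact: block_measurable.
Qed.

(** * Cylinder sets and the projective limit *)

Section cylinders.
Context (R : realType) (V : ptopologicalType).
Notation M := (pmeasure R V).

Definition cylinder (C : set M) :=
  exists (I : fpartition V) (B : set (borel (simplex R I))),
    measurable B /\ C = @evaluation R V I @^-1` B.

Lemma cylinder_lift (I L : fpartition V)
    (s : 'I_(psize I) -> {set 'I_(psize L)}) (sIL : coarsening s) (B : set (simplex R I)) :
  @evaluation R V I @^-1` B = @evaluation R V L @^-1` (coarsen sIL @^-1` B).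
Proof.
apply/seteqP; split=> x /=; by rewrite (coarsen_evaluation sIL).
Qed.

Lemma measurable_preimage_coarsen (I L : fpartition V)
    (s : 'I_(psize I) -> {set 'I_(psize L)}) (sIL : coarsening s)
    (B : set (borel (simplex R I))) : measurable B ->
  measurable (coarsen sIL @^-1` B : set (borel (simplex R L))).
Proof.
move=> mB; rewrite -[X in measurable X]setTI.
exact: (@measurable_coarsen R V I L s sIL).
Qed.

Lemma cylinder_pair (C D : set M) : cylinder C -> cylinder D ->
  exists (L : fpartition V) (B B' : set (borel (simplex R L))),
    [/\ measurable B, measurable B', C = @evaluation R V L @^-1` B &
        D = @evaluation R V L @^-1` B'].
Proof.
move=> [I [B [mB ->]]] [J [B' [mB' ->]]].
have [L [s [t [sIL tJL]]]] := common_refinement I J.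
exists L, (coarsen sIL @^-1` B), (coarsen tJL @^-1` B'); split.
- exact: measurable_preimage_coarsen.
- exact: measurable_preimage_coarsen.
- exact: cylinder_lift.
- exact: cylinder_lift.
Qed.

(** Surjectivity of the evaluation: over a given partition, a cylinder determines its base. *)
Lemma preimage_evaluation_inj (I : fpartition V) (B B' : set (simplex R I)) :
  @evaluation R V I @^-1` B `<=` @evaluation R V I @^-1` B' -> B `<=` B'.
Proof.
by move=> BB' z; have [x <-] := evaluation_surjective z; exact: BB'.
Qed.

Lemma mass_gt_cylinder (A : set (borel V)) (q : R) : measurable A ->
  cylinder [set x : M | q < mass x A].
Proof.
move=> mA; have [J [t At]] := partition_of_set mA.
have [mf _] := bounded_measurable_blocks R t.
eexists J, (_ @^-1` `]q, +oo[); split.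
  by rewrite -[X in measurable X]setTI; exact: mf.
by apply/seteqP; split=> x; rewrite /= in_itv/= andbT At mass_evaluation.
Qed.

Lemma cylinder_algebra : is_algebra cylinder.
Proof.
split.
- rewrite (_ : set0 = [set x : M | 1 < mass x [set: V]]).
    exact/mass_gt_cylinder/measurableT.
  by apply/seteqP; split => x //=; rewrite massT ltxx.
- move=> C D cC cD; have [L [B [B' [mB mB' -> ->]]]] := cylinder_pair cC cD.
  by exists L, (B `|` B'); split; [exact: measurableU|].
- move=> _ [I [B [mB ->]]]; exists I, (~` B); split => //.
  exact: measurableC.
Qed.

Hypothesis polishV : polish R V.

Lemma cylinder_measurable (C : set M) : cylinder C ->
  measurable (C : set (borel M)).
Proof.
move=> [I [B [mB ->]]].
have := measurable_evaluation polishV (@measurableT _ (borel M)) mB.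
by rewrite setTI.
Qed.

Lemma open_sub_cylinders : @open M `<=` <<s cylinder >>.
Proof.
move=> W; apply: weak_star_open_ind => //.
- exact: (@measurableT _ (g_sigma_algebraType cylinder)).
- exact: (@measurableI _ (g_sigma_algebraType cylinder)).
- by move=> F FW; exact: sigma_algebra_bigcup.
- move=> U q oU; apply: sub_sigma_algebra.
  by apply: mass_gt_cylinder; exact: open_measurable_borel.
Qed.

Lemma borel_cylindersE : @measurable _ (borel M) = <<s cylinder >>.
Proof.
apply/seteqP; split; last first.
  apply: smallest_sub; first exact: sigma_algebra_measurable.
  exact: cylinder_measurable.
apply: smallest_sub; first exact: smallest_sigma_algebra.
exact: open_sub_cylinders.
Qed.

(** The cylinders form a pi-system generating the weak* Borel sets, and normalised measures that
    agree on these are equal. *)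
Lemma eq_on_cylinders (P Q : pmeasure R M) :
  (forall C, cylinder C -> P C = Q C) -> P = Q.
Proof.
move=> PQ; apply: pmeasure_ext => A mA.
apply: (@measure_unique _ R (borel M) cylinder (fun=> setT)) => //.
- exact: borel_cylindersE.
- by move=> C D cC cD; exact: (algebraI cylinder_algebra).
- by move=> _; exact: (algebraT cylinder_algebra).
- by rewrite bigcup_const//; exists 0%N.
- by move=> _; rewrite [X in (X < _)%E](probability_setT P) ltry.
Qed.

End cylinders.

(** * The content on cylinders and its continuity at the empty set *)

Section family.
Context (R : realType) (V : ptopologicalType).
Hypothesis polishV : polish R V.
Notation M := (pmeasure R V).
Variable P_ : forall I : fpartition V, pmeasure R (simplex R I).

Lemma mean_blocks (G : M) (I : fpartition V) (t : {set 'I_(psize I)}) :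
  family_mean P_ G ->
  \int[P_ I]_(z in [set: borel (simplex R I)])
    (\sum_(j in t) simplex_val (z : simplex R I) ord0 j) =
  mass G (\bigcup_(j in [set j | j \in t]) block j).
Proof.
move=> mG; rewrite (@bounded_Rintegral_sum _ (borel (simplex R I)) R (P_ I) _ _
  (fun j => j \in t)
  (fun j (z : borel (simplex R I)) => simplex_val (z : simplex R I) ord0 j)).
  rewrite mass_evaluation; apply: eq_bigr => j _.
  by have /rowP/(_ j) := mG I; rewrite mxE.
move=> j; have := bounded_measurable_blocks R [set j]%SET.
by under eq_fun do rewrite big_set1.
Qed.

Hypothesis proj : projective_family P_.

Lemma mass_coarsen (I L : fpartition V)
    (s : 'I_(psize I) -> {set 'I_(psize L)}) (sIL : coarsening s)
    (B : set (borel (simplex R I))) : measurable B ->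
  mass (P_ I) B = mass (P_ L) (coarsen sIL @^-1` B).
Proof. by move=> mB; rewrite /mass (proj sIL mB). Qed.

(* The value is 0 off the cylinder sets. *)
Definition cylinder_content (C : set M) : R :=
  xget 0 [set r | exists (I : fpartition V) (B : set (borel (simplex R I))),
    [/\ measurable B, C = @evaluation R V I @^-1` B & r = mass (P_ I) B]].

(** Two representations of a cylinder are lifted to a common refinement: there the bases coincide,
    and projectivity preserves their masses. *)
Lemma cylinder_contentE (I : fpartition V) (B : set (borel (simplex R I))) :
  measurable B -> cylinder_content (@evaluation R V I @^-1` B) = mass (P_ I) B.
Proof.
move=> mB; apply: xget_unique; first by exists I, B.
move=> _ [J [B' [mB' BB' ->]]].
have [L [s [t [sIL tJL]]]] := common_refinement I J.
rewrite (mass_coarsen sIL mB) (mass_coarsen tJL mB'); congr mass.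
rewrite (cylinder_lift sIL) (cylinder_lift tJL) in BB'.
by apply/seteqP; split; apply: preimage_evaluation_inj; rewrite BB'.
Qed.

Lemma cylinder_content_ge0 C : 0 <= cylinder_content C.
Proof.
rewrite /cylinder_content; case: xgetP => // _ _ [I [B [_ _ ->]]].
exact: mass_ge0.
Qed.

Lemma cylinder_contentT : cylinder_content setT = 1.
Proof.
have [I _] := @partition_of_set V setT measurableT.
by rewrite -(preimage_setT (@evaluation R V I)) cylinder_contentE ?massT.
Qed.

Lemma cylinder_contentU C D : cylinder C -> cylinder D -> C `&` D = set0 ->
  cylinder_content (C `|` D) = cylinder_content C + cylinder_content D.
Proof.
move=> cC cD CD; have [L [B [B' [mB mB' CB DB]]]] := cylinder_pair cC cD.
rewrite CB DB -preimage_setU !cylinder_contentE//; last exact: measurableU.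
rewrite massU// -subset0; apply: preimage_evaluation_inj.
by rewrite preimage_setI -CB -DB CD.
Qed.

Variable G : M.
Hypothesis mG : family_mean P_ G.

(** Markov's inequality on the simplex of a partition having [A] as a union of blocks; it replaces
    [mean_markov] as long as only the content is at hand. *)
Lemma cylinder_content_markov (A : set (borel V)) (r : R) : measurable A ->
  0 < r -> r * cylinder_content [set x : M | r < mass x A] <= mass G A.
Proof.
move=> mA r0; have [I [t At]] := partition_of_set mA.
pose f (z : borel (simplex R I)) : R :=
  \sum_(j in t) simplex_val (z : simplex R I) ord0 j.
have bf : bounded_measurable f := bounded_measurable_blocks R t.
have mS : measurable (f @^-1` `]r, +oo[ : set (borel (simplex R I))).
  by rewrite -[X in measurable X]setTI; exact: bf.1.
rewrite (_ : [set x : M | _] =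
    @evaluation R V I @^-1` (f @^-1` `]r, +oo[)); last first.
  by apply/seteqP; split=> x; rewrite /= in_itv/= andbT At mass_evaluation.
rewrite cylinder_contentE// At -mean_blocks// -Rintegral_indic//.
rewrite -RintegralZl//; last first.
  exact/bounded_measurable_integrable/bounded_measurable_indic.
apply: le_bounded_Rintegral => //.
  exact/bounded_measurableZ/bounded_measurable_indic.
move=> z; rewrite indicE; have [rz|rz] := pselect ((f @^-1` `]r, +oo[) z).
  by rewrite mem_set// mulr1; move: rz; rewrite /= in_itv/= andbT; exact: ltW.
by rewrite memNset// mulr0 sumr_ge0// => j _; exact: simplex_val_ge0.
Qed.

(** Evaluation at Borel blocks is in general not weak* continuous, so convergence of the block
    masses is assumed; it is what keeps the limit in the closed set. *)
Lemma evaluation_closed_cvg (I : fpartition V) (D : set (simplex R I))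
    (F : set_system M) (x : M) : ProperFilter F -> closed D ->
  (forall i, mass (y : M) (block (f := I) i) @[y --> F] -->
    mass x (block (f := I) i)) ->
  F (@evaluation R V I @^-1` D) -> D (evaluation I x).
Proof.
move=> FF cD Fx FD; apply: contrapT => nDx.
suff FND : F (@evaluation R V I @^-1` (~` D)).
  have : F set0 by apply: filterS (filterI FD FND) => y [].
  exact: filter_not_empty.
(* The claim is generalised from the complement of [D] to all open [W], and the subbase induction
   reduces it to a bound on a single block mass. *)
move: nDx; pose P W := W (evaluation I x) -> F (@evaluation R V I @^-1` W).
rewrite -[~ _]/((~` D) (evaluation I x)) -/(P (~` D)).
apply: (@simplex_open_ind R V I P); last exact: closed_openC; rewrite /P.
- by move=> _; rewrite preimage_setT; exact: filterT.
- by move=> A B PA PB [/PA FA /PB FB]; rewrite preimage_setI; exact: filterI.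
- by move=> W PW [n _ /PW]; apply: filterS => y; exists n.
- move=> i q /=; rewrite evaluationE => qx.
  apply: (@filterS _ F _ [set y : M | q < mass y (block i)]).
    by move=> y; rewrite /= evaluationE.
  exact: (cvgr_gt _ (Fx i) _ qx).
- move=> i q /=; rewrite evaluationE => qx.
  apply: (@filterS _ F _ [set y : M | mass y (block i) < q]).
    by move=> y; rewrite /= evaluationE.
  exact: (cvgr_lt _ (Fx i) _ qx).
Qed.

(** By contradiction: if the contents stay above [e], removing exceptional cylinders of total
    content at most [e / 2] leaves nonempty sets [S n]. An ultrafilter containing them has an
    ultralimit, which lies in every [H n]. *)
Lemma cylinder_content_cvg0 (H : (set M)^nat) : (forall n, cylinder (H n)) ->
  nonincreasing_seq H -> \bigcap_n H n = set0 ->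
  forall e : R, 0 < e -> exists n, cylinder_content (H n) < e.
Proof.
move=> cH niH H0 e e0; apply: contrapT => /forallNP Hge.
have {}Hge n : e <= cylinder_content (H n) by rewrite leNgt; apply/negP.
suff [x xH] : exists x, forall n, H n x.
  by have : (\bigcap_n H n) x by []; rewrite H0.
have cA := @cylinder_algebra R V.
(* One [e / 4] is spent on the closed approximations, a second one below on the compact
   approximations. *)
have w0 n : 0 < e / 4 / 2 ^+ n.+1 by rewrite !divr_gt0// exprn_gt0.
have /choice[ID IDP] n : exists ID : {I : fpartition V & set (simplex R I)},
    [/\ closed (projT2 ID),
      @evaluation R V (projT1 ID) @^-1` (projT2 ID) `<=` H n &
      cylinder_content (H n `\` (@evaluation R V (projT1 ID) @^-1` (projT2 ID)))
        <= e / 4 / 2 ^+ n.+1].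
  have [I [B [mB ->]]] := cH n.
  have [D [cD DB BD]] :=
    closed_regularity (@simplex_Fsigma R V I) (P_ I) mB (w0 n).
  exists (existT _ I D); split => //=; first by move=> x; exact: DB.
  rewrite (_ : _ `\` _ = @evaluation R V I @^-1` (B `\` D))//.
  rewrite cylinder_contentE//; apply: measurableD => //.
  exact: closed_measurable_borel.
pose I n := projT1 (ID n).
pose E n := @evaluation R V (I n) @^-1` (projT2 (ID n)).
have cE n : cylinder (E n).
  exists (I n), (projT2 (ID n)); split => //; apply: closed_measurable_borel.
  by case: (IDP n).
have [b [ob bP]] := polish_base polishV.
(* All blocks of all the partitions [I n], numbered by pairs; an index out of range gives the empty
   set. *)
pose bl (p : nat * nat) : set V :=
  oapp (fun j : 'I_(psize (I p.1)) => block j) set0 (insub p.2).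
(* The algebra contains a base, so that it generates the Borel sets, and the blocks, so that the
   ultralimit is controlled in each simplex. *)
pose c k := match @unpickle (nat + nat * nat)%type k with
  | Some (inl n) => b n | Some (inr p) => bl p | None => set0 end.
have [a [aG Gc aH]] := countable_algebra c.
have ma n : measurable (a n : set (borel V)).
  apply: aH => [|k].
    split; first exact: (@measurable0 _ (borel V)).
    - exact: (@measurableU _ (borel V)).
    - exact: (@measurableC _ (borel V)).
  rewrite /c; case: unpickle => [[m|p]|]; last exact: (@measurable0 _ (borel V)).
    exact: open_measurable_borel.
  rewrite /bl; case: insub => [j|]; last exact: (@measurable0 _ (borel V)).
  exact: block_measurable.
have Gb n : range a (b n).
  by have := Gc (pickle (inl n : nat + nat * nat)); rewrite /c pickleK.
have Gbl n (i : 'I_(psize (I n))) : range a (block i).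
  have := Gc (pickle (inr (n, i : nat) : nat + nat * nat)).
  by rewrite /c pickleK /bl/= valK.
have /choice[K KP] (p : nat * nat) : exists K : set V,
    [/\ compact K, closed K, K `<=` a p.1 &
     mass G (a p.1 `\` K) <= e / 4 / 2 ^+ (pickle p).+1 / p.2.+1%:R].
  have wp : 0 < e / 4 / 2 ^+ (pickle p).+1 / p.2.+1%:R by rewrite divr_gt0.
  have [K [U [[kK cK] oU Ka aU KU]]] :=
    polish_regularity polishV G (ma p.1) wp.
  exists K; split => //; apply: le_trans KU; apply: le_mass.
  - by apply: measurableD; [exact: ma|exact: closed_measurable_borel].
  - apply: measurableD; first exact: open_measurable_borel.
    exact: closed_measurable_borel.
  - by move=> v [/aU].
have maK p : measurable (a p.1 `\` K p : set (borel V)).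
  by apply: measurableD => //; apply: closed_measurable_borel; case: (KP p).
(* The measures that are badly approximated on one of the sets a i. *)
pose N n : set M := if @pickle_inv (nat * nat)%type n is Some p then
  [set x : M | p.2.+1%:R^-1 < mass x (a p.1 `\` K p)] else set0.
have cN n : cylinder (N n).
  rewrite /N; case: pickle_inv => [p|]; last exact: (algebra0 cA).
  exact: mass_gt_cylinder.
have content0 : cylinder_content set0 = 0.
  exact: (content_set0 cA cylinder_contentU).
have Ne n : cylinder_content (N n) <= e / 4 / 2 ^+ n.+1.
  rewrite /N; case np : (@pickle_inv (nat * nat)%type n) => [p|]; last first.
    by rewrite content0; exact: ltW.
  have nE : pickle p = n by have := @pickle_invK (nat * nat)%type n; rewrite np.
  have p0 : (0 : R) < p.2.+1%:R^-1 by rewrite invr_gt0.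
  have := cylinder_content_markov (maK p) p0; rewrite mulrC ler_pdivrMr//.
  move=> /le_trans; have [_ _ _ pK] := KP p; apply.
  by rewrite -ler_pdivlMr ?ltr0n// (le_trans pK)// nE.
(* What must be avoided at stage [n]: poor compact approximation, or leaving the closed cylinder
   [E n] inside [H n]. *)
pose B n := N n `|` (H n `\` E n).
have cB n : cylinder (B n) by apply: (algebraU cA) => //; exact: (algebraD cA).
have Be n : cylinder_content (B n) <= e / 2 / 2 ^+ n.+1.
  apply: le_trans (content_leU cA cylinder_content_ge0 cylinder_contentU
    (cN n) _) _.
    exact: (algebraD cA).
  have -> : e / 2 / 2 ^+ n.+1 = e / 4 / 2 ^+ n.+1 + e / 4 / 2 ^+ n.+1.
    by rewrite -mulrDl; congr (_ * _); lra.
  by rewrite lerD//; case: (IDP n).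
pose S n := H n `\` \big[setU/set0]_(k < n.+1) B k.
have S0 n : S n !=set0.
  apply: contrapT => /set0P/negP; rewrite negbK => /eqP Sn.
  have HB : H n `<=` \big[setU/set0]_(k < n.+1) B k.
    move=> x Hx; apply: contrapT => nBx.
    by have : S n x by []; rewrite Sn.
  have := le_trans (Hge n) (content_le cA cylinder_content_ge0 cylinder_contentU
    (cH n) (algebra_bigU cA n.+1 cB) HB).
  move=> /le_trans/(_ (content_bigsetU_le cA cylinder_content_ge0
    cylinder_contentU n.+1 cB)).
  have e20 : 0 <= e / 2 by rewrite divr_ge0// ltW.
  have BE : \sum_(k < n.+1) cylinder_content (B k) <= e / 2.
    by apply: le_trans (sum_halves_le n.+1 e20); apply: ler_sum.
  by move=> /le_trans/(_ BE); lra.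
have niS m n : (m <= n)%N -> S n `<=` S m.
  move=> mn x [Hx nBx]; split; first by move: Hx; apply/subsetPset/niH.
  by apply: contra_not nBx; exact: subset_bigsetU.
have FF : ProperFilter (filter_from [set: nat] S).
  apply: filter_from_proper; last by move=> n _; exact: S0.
  apply: filter_from_filter; first by exists 0%N.
  move=> m n _ _; exists (maxn m n) => // x Sx.
  by split; [apply: niS Sx; exact: leq_maxl|apply: niS Sx; exact: leq_maxr].
have [F [uF SF]] := ultraFilterLemma FF.
have FS n : F (S n) by apply: SF; exists n.
have SB n : S n `<=` ~` B n.
  move=> x [_ nBx] Bx; apply: nBx.
  by rewrite big_ord_recr; right.
have [||x xP] := ultralimit uF aG _ (base_open_sub_sigma ob bP aG Gb).
- by move=> _ [n _ <-].
- move=> _ d [i _ <-] d0; have [m md] := natSinv_lt d0.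
  have [kK cK Ka _] := KP (i, m); exists (K (i, m)); split => //.
  apply: filterS (FS (pickle (i, m))) => y /SB nBy; apply: le_trans (ltW md).
  rewrite leNgt; apply/negP => ym; apply: nBy; left.
  by rewrite /N pickleK_inv.
exists x => n; have [cD DH _] := IDP n; apply: DH.
(* [S n] lies in [H n] and avoids its part outside [E n], so [F] contains [E n]; closedness passes
   this on to the limit [x]. *)
apply: (evaluation_closed_cvg (F := F) _ cD) => [i|].
  by apply: xP; exact: Gbl.
apply: filterS (FS n) => y Sy; apply: contrapT => nEy.
by apply: (SB n y Sy); right; split => //; case: Sy.
Qed.

Lemma random_measure_exists : exists P : pmeasure R M, has_marginals P_ P.
Proof.
have [p pE] := caratheodory_extension (@cylinder_algebra R V)
  cylinder_content_ge0 cylinder_contentT cylinder_contentU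
  cylinder_content_cvg0 (open_sub_cylinders polishV).
exists (normalise p) => I B mB.
have cB : cylinder (@evaluation R V I @^-1` B) by exists I, B.
rewrite /pushforward /pmeasure_val/= /off_measurable0 asboolT; last first.
  exact: cylinder_measurable.
by rewrite pE// cylinder_contentE// -massE.
Qed.

End family.

(** * Transfer between [P] and its marginals *)

Section mean.
Context (R : realType) (V : ptopologicalType).
Hypothesis polishV : polish R V.
Notation M := (pmeasure R V).
Variable P_ : forall I : fpartition V, pmeasure R (simplex R I).

Lemma has_meanP (P : pmeasure R M) (G : M) : has_mean P G <->
  forall A : set (borel V), measurable A ->
    \int[P]_(x in [set: borel M]) mass (x : M) A = mass G A.
Proof.
have E (A : set (borel V)) : measurable A -> random_measure_mean P A =
    (\int[P]_(x in [set: borel M]) mass (x : M) A)%:E.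
  move=> mA; rewrite /random_measure_mean /Rintegral fineK.
    by apply: eq_integral => x _; rewrite -massE.
  apply: integrable_fin_num => //; apply: bounded_measurable_integrable.
  exact: bounded_measurable_mass.
split=> mG A mA; first by have := mG A mA; rewrite E// massE// => -[].
by rewrite E// mG// -massE.
Qed.

Lemma integral_marginal (P : pmeasure R M) (I : fpartition V) i :
  has_marginals P_ P ->
  \int[P_ I]_(z in [set: borel (simplex R I)])
    simplex_val (z : simplex R I) ord0 i =
  \int[P]_(x in [set: borel M]) mass (x : M) (block (f := I) i).
Proof.
move=> PP; rewrite /Rintegral; congr fine.
have me := measurable_evaluation polishV (I := I).
rewrite (eq_measure_integral
  (pushforward P (@evaluation R V I : borel M -> borel (simplex R I)))).
  rewrite ge0_integral_pushforward//.
  - by rewrite preimage_setT; apply: eq_integral => x _ /=; rewrite evaluationE.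
  - by apply/measurable_EFinP; exact: measurable_simplex_coord.
  - by move=> z _; rewrite lee_fin simplex_val_ge0.
by move=> A mA _; exact: PP.
Qed.

Lemma family_mean_of_mean (P : pmeasure R M) (G : M) :
  has_marginals P_ P -> has_mean P G -> family_mean P_ G.
Proof.
move=> PP /has_meanP mG I; apply/rowP => i; rewrite mxE (integral_marginal i PP).
by rewrite mG ?evaluationE//; exact: block_measurable.
Qed.

(** Each Borel set is a finite union of blocks of some partition, where the mean is a finite sum of
    coordinate means. *)
Lemma mean_of_family_mean (P : pmeasure R M) (G : M) :
  has_marginals P_ P -> family_mean P_ G -> has_mean P G.
Proof.
move=> PP mG; apply/has_meanP => A mA.
have [I [t ->]] := partition_of_set mA; rewrite mass_blocks.
under eq_Rintegral do rewrite mass_blocks.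
rewrite (@bounded_Rintegral_sum _ (borel M) R P _ _ (fun j => j \in t)
  (fun j (x : borel M) => mass (x : M) (block j))).
  apply: eq_bigr => j _; rewrite -(integral_marginal j PP).
  by have /rowP/(_ j) := mG I; rewrite mxE evaluationE.
by move=> j; apply: bounded_measurable_mass => //; exact: block_measurable.
Qed.

(** Evaluation on [I] factors as evaluation on the finer [J] followed by coarsening. *)
Lemma marginals_projective (P : pmeasure R M) :
  has_marginals P_ P -> projective_family P_.
Proof.
move=> PP I J s sIJ B mB; rewrite (PP I B mB) /pushforward (cylinder_lift sIJ).
by rewrite [in RHS]PP//; exact: measurable_preimage_coarsen.
Qed.

Lemma marginals_unique (P Q : pmeasure R M) :
  has_marginals P_ P -> has_marginals P_ Q -> P = Q.
Proof.
move=> PP PQ; apply: (eq_on_cylinders polishV) => _ [I [B [mB ->]]].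
by have := PP I B mB; rewrite (PQ I B mB).
Qed.

(** A compact inner approximation with defect [e] gives one inequality, monotonicity the other. *)
Lemma mean_radon (P : pmeasure R M) (G : M) : has_mean P G -> is_radon P.
Proof.
move=> /has_meanP mG B mB; apply/eqP; rewrite eq_le; apply/andP; split.
  apply/lee_addgt0Pr => e e0.
  have [X [kX cX XB BX]] := random_measure_radon polishV mG mB e0.
  have mX := closed_measurable_borel cX.
  apply: (@le_trans _ _ (P X + e%:E)%E).
    rewrite (massE P mB) (massE P mX) -EFinD lee_fin addrC.
    by rewrite (le_trans (massD P mB mX))// lerD2r.
  by rewrite leeD2r// ereal_sup_ubound//; exists X.
apply: ub_ereal_sup => _ [K [kK mK KB] <-].
by apply: le_measure; rewrite ?inE.
Qed.

End mean.

Theorem theorem1p1 (R : realType) (V : ptopologicalType) (polishV : polish R V)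
    (P_ : forall I : fpartition V, pmeasure R (simplex R I)) :
  let statement1 :=
    projective_family P_ /\ exists G0 : pmeasure R V, family_mean P_ G0 in
  let solution (P : pmeasure R (pmeasure R V)) :=
    has_marginals P_ P /\ exists G0 : pmeasure R V, has_mean P G0 in
  let statement2 := exists! P, solution P in
  [/\ statement1 <-> statement2,
      statement1 \/ statement2 ->
        forall (P : pmeasure R (pmeasure R V)) (G0 G1 : pmeasure R V),
          family_mean P_ G0 -> has_marginals P_ P -> has_mean P G1 -> G0 = G1
    & statement1 \/ statement2 -> forall P, solution P -> is_radon P].
Proof.
move=> statement1 solution statement2; split.
- split=> [[proj [G mG]]|[P [[PP [G mG]] _]]].
    have [P PP] := random_measure_exists polishV proj mG.
    exists P; split.
      by split => //; exists G; exact: mean_of_family_mean PP mG.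
    by move=> Q [PQ _]; exact: marginals_unique PP PQ.
  split; first exact: marginals_projective PP.
  by exists G; exact: family_mean_of_mean PP mG.
(* Through the marginals [G0] is also a mean of [P], and the mean is determined on measurable
   sets. *)
- move=> _ P G0 G1 mG0 PP mG1; apply: pmeasure_ext => A mA.
  by rewrite -mG1// (mean_of_family_mean polishV PP mG0).
- by move=> _ P [_ [G mG]]; exact: mean_radon mG.
Qed.
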